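(* For every integer $n\ge1$ define $$C_n^H=\int_0^\infty\frac1t e^{-t}f_1(i,t)\left[-1+{}_4F_3\!\left(\tfrac14-n,\tfrac12-n,\tfrac34-n,-n;\tfrac14,\tfrac12,\tfrac34;\frac{t^4}{\tilde\omega^4}\right)\right]dt.$$ Then $$\frac{4^{2n-1}}{8n}\tilde H_{4n}=C_n^H-\sum_{k=1}^{n-1}\binom{4n}{4k}\frac{4^{2k-1}}{8k}\tilde H_{4k}.$$
   Context: Let $\tilde\omega=2\int_0^1\frac{dx}{\sqrt{1-x^4}}=\frac{\sqrt\pi}{2}\frac{\Gamma(1/4)}{\Gamma(3/4)}$, and let $\wp$ be the Weierstrass elliptic function with period lattice $\tilde\omega\mathbb Z+\tilde\omega i\mathbb Z$. The Hurwitz numbers $\tilde H_n$ ($n\ge2$) are defined by the Laurent expansion $\wp(z)=\frac1{z^2}+\sum_{n\ge2}\frac{2^n\tilde H_n}{n}\frac{z^{n-2}}{(n-2)!}$ about $z=0$. Here $f_1(i,t)=\dfrac{\cos^2(t/2)}{1-2e^{-t}\cos t+e^{-2t}}$, and ${}_4F_3(a_1,\dots,a_4;b_1,b_2,b_3;x)=\sum_{k\ge0}\frac{(a_1)_k\cdots(a_4)_k}{(b_1)_k(b_2)_k(b_3)_k}\frac{x^k}{k!}$ with $(a)_k$ the Pochhammer symbol (the series here terminates). *)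

(* Defs.v *)
From Stdlib Require Import Reals Arith.
Open Scope R_scope.

Fixpoint rsum (f : nat -> R) (n : nat) : R :=
  match n with O => 0 | S m => rsum f m + f m end.

Definition Cx := (R * R)%type.
Definition cadd (z w : Cx) : Cx := (fst z + fst w, snd z + snd w).
Definition csub (z w : Cx) : Cx := (fst z - fst w, snd z - snd w).
Definition cmul (z w : Cx) : Cx :=
  (fst z * fst w - snd z * snd w, fst z * snd w + snd z * fst w).
Definition cinv (z : Cx) : Cx :=
  (fst z / (fst z ^ 2 + snd z ^ 2), - snd z / (fst z ^ 2 + snd z ^ 2)).
Definition csq (z : Cx) : Cx := cmul z z.
Fixpoint csum (f : nat -> Cx) (n : nat) : Cx :=
  match n with O => (0, 0) | S m => cadd (csum f m) (f m) end.

Definition latpt (om : R) (N i0 j0 : nat) : Cx :=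
  (om * (INR i0 - INR N), om * (INR j0 - INR N)).

(* Square partial sum of the Weierstrass series for the lattice om Z + om i Z:
   1/z^2 + sum_{w <> 0, w = om(m+ik), |m|,|k| <= N} (1/(z-w)^2 - 1/w^2). *)
Definition wp_partial (om : R) (z : Cx) (N : nat) : Cx :=
  cadd (cinv (csq z))
    (csum (fun i0 => csum (fun j0 =>
        if andb (Nat.eqb i0 N) (Nat.eqb j0 N) then (0, 0)
        else csub (cinv (csq (csub z (latpt om N i0 j0))))
                  (cinv (csq (latpt om N i0 j0)))
      ) (2 * N + 1)) (2 * N + 1)).


(* wp_om(z) = p : the (absolutely convergent) lattice series converges to p. *)
Definition is_wp (om : R) (z p : Cx) : Prop :=
  Un_cv (fun N => fst (wp_partial om z N)) (fst p) /\
  Un_cv (fun N => snd (wp_partial om z N)) (snd p).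

Definition improper_int_right (f : R -> R) (a b l : R) : Prop :=
  forall eps, 0 < eps -> exists d, 0 < d /\
    forall c, b - d < c < b ->
      exists pr : Riemann_integrable f a c, Rabs (RiemannInt pr - l) < eps.

Definition improper_int_0_inf (f : R -> R) (l : R) : Prop :=
  forall eps, 0 < eps -> exists d M, 0 < d /\ 0 < M /\
    forall a b, 0 < a < d -> M < b ->
      exists pr : Riemann_integrable f a b, Rabs (RiemannInt pr - l) < eps.

Fixpoint poch (a : R) (k : nat) : R :=
  match k with O => 1 | S j => poch a j * (a + INR j) end.

(* 4F3(1/4-n, 1/2-n, 3/4-n, -n; 1/4, 1/2, 3/4; x); terminates since (-n)_k = 0 for k > n. *)
Definition F43 (n : nat) (x : R) : R :=
  rsum (fun k =>
    poch (1/4 - INR n) k * poch (1/2 - INR n) k * poch (3/4 - INR n) k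
      * poch (- INR n) k
    / (poch (1/4) k * poch (1/2) k * poch (3/4) k)
    * x ^ k / INR (Factorial.fact k)) (S n).

Definition f1i (t : R) : R :=
  (cos (t / 2)) ^ 2 / (1 - 2 * exp (- t) * cos t + exp (- 2 * t)).

Definition CH_integrand (om : R) (n : nat) (t : R) : R :=
  / t * exp (- t) * f1i t * (-1 + F43 n (t ^ 4 / om ^ 4)).

(* Hurwitz number from the Laurent coefficients a:
   wp(z) = 1/z^2 + sum_k a_k z^k, and a_{m-2} = 2^m H_m / (m (m-2)!). *)
Definition hurwitz (a : nat -> R) (m : nat) : R :=
  INR m * INR (Factorial.fact (m - 2)) * a (m - 2)%nat / 2 ^ m.

(* Main.v *)
Require Import Defs.
From Stdlib Require Import Reals Arith Lra Lia.
From Coquelicot Require Import Coquelicot.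
Open Scope R_scope.

(** Group the nonzero Gaussian integers into the spheres [max(|m|,|k|) = A], and let
    [S_m] be the sum over [A >= 1] of the real parts of [(A + ib)^(-m)], [-A <= b < A].
    Each sphere is the union of the four quarter turns of such a side, so the Laurent
    coefficient of [x^(4k-2)] in the Weierstrass function is
    [4 (4k - 1) om^(-4k) S_(4k)], which gives
    [4^(2k-1)/(8k) H_(4k) = (4k-1)!/2 om^(-4k) S_(4k)].
    On the other side the hypergeometric polynomial is the sum of the
    [binom(4n,4k) (t/om)^(4k)], and summing Dirichlet kernels gives
    [2 e^(-t) f_1(i,t) = sum_(A >= 1) e^(-At) sum_(-A <= b < A) cos(bt)]; integrating
    against [t^(4k-1)] term by term turns each [k] into [binom(4n,4k) (4k-1)!/2 om^(-4k) S_(4k)]. *)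

(** Both sides hide an interchange of limits, and each is carried out on finite truncations with
    explicit errors. In the Weierstrass series a quarter turn orbit keeps only the powers of x with
    exponent 2 mod 4 and has size x^2 |w|^(-4), so the error is uniform in the size of the square;
    the Laurent coefficients are then read off as x tends to 0 along the positive axis. In the
    integral, the tail of the series in A is controlled only up to a factor t^(-2) near 0. The
    missing t^2 is borrowed from t^(4k-1), which is possible because the -1 in the integrand leaves
    only k >= 1. The sums S_(4k) are never evaluated: the summand k of C_n^H is binom(4n,4k) times
    the normalised Hurwitz number of index 4k, and the recurrence isolates the summand k = n. *)

(** * Finite sums *)

Lemma rsum_ext (f g : nat -> R) (n : nat) :
  (forall k, (k < n)%nat -> f k = g k) -> rsum f n = rsum g n.
Proof.
  induction n as [|n IH]; intros H; simpl; [reflexivity|].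
  rewrite IH, H; auto with arith.
Qed.

Lemma rsum_plus (f g : nat -> R) (n : nat) :
  rsum (fun k => f k + g k) n = rsum f n + rsum g n.
Proof. induction n as [|n IH]; simpl; [lra|]. rewrite IH; lra. Qed.

Lemma rsum_scal (c : R) (f : nat -> R) (n : nat) :
  rsum (fun k => c * f k) n = c * rsum f n.
Proof. induction n as [|n IH]; simpl; [lra|]. rewrite IH; lra. Qed.

Lemma rsum_minus (f g : nat -> R) (n : nat) :
  rsum (fun k => f k - g k) n = rsum f n - rsum g n.
Proof. induction n as [|n IH]; simpl; [lra|]. rewrite IH; lra. Qed.

Lemma rsum_const (c : R) (n : nat) : rsum (fun _ => c) n = INR n * c.
Proof. induction n as [|n IH]; [simpl; lra|]. rewrite S_INR; simpl; lra. Qed.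

Lemma Rabs_rsum_le (f g : nat -> R) (n : nat) :
  (forall k, (k < n)%nat -> Rabs (f k) <= g k) -> Rabs (rsum f n) <= rsum g n.
Proof.
  induction n as [|n IH]; intros H; simpl; [rewrite Rabs_R0; lra|].
  eapply Rle_trans; [apply Rabs_triang|].
  apply Rplus_le_compat; auto with arith.
Qed.

Lemma rsum_first (f : nat -> R) (n : nat) :
  rsum f (S n) = f O + rsum (fun k => f (S k)) n.
Proof.
  induction n as [|n IH]; [simpl; lra|].
  change (rsum f (S (S n))) with (rsum f (S n) + f (S n)).
  rewrite IH; simpl; lra.
Qed.

Lemma rsum_exchange (f : nat -> nat -> R) (n m : nat) :
  rsum (fun i => rsum (fun j => f i j) m) n = rsum (fun j => rsum (fun i => f i j) n) m.
Proof.
  induction n as [|n IH]; simpl.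
  - rewrite rsum_const; lra.
  - rewrite rsum_plus, IH; reflexivity.
Qed.

Lemma rsum_rev (f : nat -> R) (n : nat) :
  rsum (fun k => f (n - S k)%nat) n = rsum f n.
Proof.
  induction n as [|n IH]; [reflexivity|].
  rewrite rsum_first.
  replace (S n - 1)%nat with n by lia.
  change (rsum f (S n)) with (rsum f n + f n).
  rewrite <- IH. rewrite Rplus_comm. f_equal.
Qed.

Lemma is_lim_seq_rsum (u : nat -> nat -> R) (l : nat -> R) (n : nat) :
  (forall k, (k < n)%nat -> is_lim_seq (fun N => u N k) (l k)) ->
  is_lim_seq (fun N => rsum (u N) n) (rsum l n).
Proof.
  induction n as [|n IH]; intros H; simpl.
  - apply is_lim_seq_const.
  - apply is_lim_seq_plus'; auto with arith.
Qed.

(** * Lattice sums over squares *)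

Definition box_sum (g : R -> R -> R) (N : nat) : R :=
  rsum (fun i => rsum (fun j => g (INR i - INR N) (INR j - INR N)) (2 * N + 1)) (2 * N + 1).

Definition rot_sum (g : R -> R -> R) (u v : R) : R :=
  g u v + g (- v) u + g (- u) (- v) + g v (- u).

(** Negation turns the half-open range -A <= b < A into -A < b <= A. Two of the four turned sides
    arise in this reversed form, whereas [box_sum] runs upwards. *)
Lemma rsum_centered_opp (h : R -> R) (A : nat) :
  rsum (fun c => h (- (INR c - INR A))) (2 * A)
  = rsum (fun c => h (INR (S c) - INR A)) (2 * A).
Proof.
  rewrite <- (rsum_rev (fun c => h (INR (S c) - INR A))).
  apply rsum_ext; intros k Hk; f_equal.
  replace (S (2 * A - S k)) with (2 * A - k)%nat by lia.
  rewrite minus_INR by lia. rewrite mult_INR; simpl; lra.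
Qed.

(* The sup-norm sphere of radius [A] is the disjoint union of the four quarter
   turns of the half-open side [{(A, b) : -A <= b < A}]. *)
Lemma box_sum_shells (g : R -> R -> R) (N : nat) : g 0 0 = 0 ->
  box_sum g N
  = rsum (fun A => rsum (fun c => rot_sum g (INR A) (INR c - INR A)) (2 * A)) (S N).
Proof.
  intros g0. induction N as [|N IH].
  (* The sphere of radius 0 has an empty side, so only [g0] accounts for the centre. *)
  { unfold box_sum; simpl. rewrite !Rminus_0_r, g0. lra. }
  set (sh := fun A => rsum (fun c => rot_sum g (INR A) (INR c - INR A)) (2 * A)) in *.
  change (rsum sh (S (S N))) with (rsum sh (S N) + sh (S N)).
  rewrite <- IH. clear IH. unfold box_sum, sh.
  set (A := S N). unfold rot_sum.
  rewrite !rsum_plus.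
  rewrite (rsum_centered_opp (fun b => g b (INR A)) A).
  rewrite (rsum_centered_opp (fun b => g (- INR A) b) A).
  replace (2 * A + 1)%nat with (S (2 * A)) by lia.
  replace (2 * A)%nat with (S (2 * N + 1)) by (unfold A; lia).
  set (M := (2 * N + 1)%nat).
  assert (EM : INR (S M) - INR A = INR A).
  { replace (S M) with (2 * A)%nat by (unfold A, M; lia). rewrite mult_INR; simpl; lra. }
  assert (E0 : INR 0 - INR A = - INR A) by (simpl; lra).
  change (rsum (fun i => rsum (fun j => g (INR i - INR A) (INR j - INR A)) (S (S M))) (S (S M)))
    with (rsum (fun i => rsum (fun j => g (INR i - INR A) (INR j - INR A)) (S (S M))) (S M)
          + rsum (fun j => g (INR (S M) - INR A) (INR j - INR A)) (S (S M))).
  rewrite rsum_first.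
  (* With the first and last rows split off, every other row gives up its two end points; the shift
     by one in both indices and [A = S N] make the rest a row of the smaller box. *)
  rewrite (rsum_ext (fun k => rsum (fun j => g (INR (S k) - INR A) (INR j - INR A)) (S (S M)))
    (fun k => g (INR (S k) - INR A) (- INR A)
        + rsum (fun j => g (INR k - INR N) (INR j - INR N)) M
        + g (INR (S k) - INR A) (INR A))).
  2:{ intros k Hk.
      change (rsum (fun j => g (INR (S k) - INR A) (INR j - INR A)) (S (S M)))
      with (rsum (fun j => g (INR (S k) - INR A) (INR j - INR A)) (S M)
        + g (INR (S k) - INR A) (INR (S M) - INR A)).
      rewrite rsum_first, E0, EM. f_equal. f_equal.
      apply rsum_ext; intros j Hj. unfold A. rewrite !S_INR. f_equal; lra. }
  rewrite !rsum_plus.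
  rewrite (rsum_first (fun j => g (INR 0 - INR A) (INR j - INR A)) (S M)).
  rewrite E0, EM.
  rewrite (rsum_first (fun k => g (INR k - INR A) (- INR A)) M), E0.
  change (rsum (fun k => g (INR (S k) - INR A) (INR A)) (S M))
    with (rsum (fun k => g (INR (S k) - INR A) (INR A)) M + g (INR (S M) - INR A) (INR A)).
  change (rsum (fun j => g (INR A) (INR j - INR A)) (S (S M)))
    with (rsum (fun j => g (INR A) (INR j - INR A)) (S M) + g (INR A) (INR (S M) - INR A)).
  rewrite EM. ring.
Qed.

(** * The Weierstrass series *)

Definition lat (om u v : R) : C := (om * u, om * v).

(** Real coordinates allow [rot_sum] to turn the term; the origin is therefore excluded by a test on
    reals instead of the index test in [wp_partial]. *)
Definition wp_term (om x u v : R) : R :=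
  let w := lat om u v in
  let t := Re (/ ((RtoC x - w) * (RtoC x - w)) - / (w * w)) in
  if Req_EM_T u 0 then if Req_EM_T v 0 then 0 else t else t.

Lemma fst_csum (f : nat -> Cx) (n : nat) :
  fst (csum f n) = rsum (fun k => fst (f k)) n.
Proof. induction n as [|n IH]; simpl; [reflexivity|]. now rewrite IH. Qed.

(** The index test and the coordinate test single out the same lattice point; elsewhere the
    arithmetic of [Cx] and that of [C] are convertible. *)
Lemma Re_wp_partial (om x : R) (N : nat) : x <> 0 ->
  fst (wp_partial om (x, 0) N) = / x ^ 2 + box_sum (wp_term om x) N.
Proof.
  intros Hx. unfold wp_partial, cadd. simpl fst. f_equal.
  - field; auto.
  - rewrite fst_csum. unfold box_sum. replace (N + (N + 0) + 1)%nat with (2 * N + 1)%nat by lia.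
    apply rsum_ext; intros i _.
    rewrite fst_csum. apply rsum_ext; intros j _. unfold wp_term.
    destruct (Nat.eqb_spec i N) as [->|Hi].
    + destruct (Req_EM_T _ 0) as [_|H]; [|exfalso; apply H; lra].
      destruct (Nat.eqb_spec j N) as [->|Hj]; simpl andb.
      * destruct (Req_EM_T _ 0) as [_|H]; [reflexivity|exfalso; apply H; lra].
      * destruct (Req_EM_T _ 0) as [H|_]; [|reflexivity].
        exfalso; apply Hj, INR_eq; lra.
    + destruct (Req_EM_T _ 0) as [H|_]; [|reflexivity].
      exfalso; apply Hi, INR_eq; lra.
Qed.

Lemma Cinv_sq_sum (z1 z2 : C) : z1 <> 0 -> z2 <> 0 ->
  (/ (z1 * z1) + / (z2 * z2) = (z1 * z1 + z2 * z2) / ((z1 * z2) * (z1 * z2)))%C.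
Proof. intros; field; auto. Qed.

Lemma Ci_sq : (Ci * Ci = - (1))%C.
Proof. unfold Ci, Cmult, Copp; simpl; f_equal; ring. Qed.

Lemma Cmult_neq0_inv (z w : C) : (z * w)%C <> 0 -> z <> 0 /\ w <> 0.
Proof. intros H; split; intros ->; apply H; ring. Qed.

(* Differentiating [sum_u 1/(x - uw) = 4x^3/(x^4 - w^4)] over the fourth roots of unity [u];
   the terms [1/(uw)^2] cancel. *)
Lemma quarter_turn_sum (x w : C) : w <> 0 -> (x ^ 4 - w ^ 4)%C <> 0 ->
  ((/ ((x - w) * (x - w)) - / (w * w))
   + (/ ((x - Ci * w) * (x - Ci * w)) - / ((Ci * w) * (Ci * w)))
   + (/ ((x - - w) * (x - - w)) - / ((- w) * (- w)))
   + (/ ((x - - (Ci * w)) * (x - - (Ci * w))) - / ((- (Ci * w)) * (- (Ci * w))))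
   = 4 * (x * x) * (x ^ 4 + 3 * w ^ 4) / ((x ^ 4 - w ^ 4) * (x ^ 4 - w ^ 4)))%C.
Proof.
  intros Hw H.
  (* [field] does not know that [Ci * Ci] is -1, so opposite points are paired and every product is
     first rewritten without [Ci]. *)
  assert (P1 : ((x - w) * (x - - w) = x * x - w * w)%C) by ring.
  assert (P2 : ((x - Ci * w) * (x - - (Ci * w)) = x * x + w * w)%C).
  { transitivity (x * x - (Ci * Ci) * (w * w))%C; [ring|]. rewrite Ci_sq; ring. }
  assert (S2 : ((x - Ci * w) * (x - Ci * w) + (x - - (Ci * w)) * (x - - (Ci * w))
                = 2 * (x * x) - 2 * (w * w))%C).
  { transitivity (2 * (x * x) + 2 * ((Ci * Ci) * (w * w)))%C; [ring|]. rewrite Ci_sq; ring. }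
  assert (I1 : ((Ci * w) * (Ci * w) = - (w * w))%C).
  { transitivity ((Ci * Ci) * (w * w))%C; [ring|]. rewrite Ci_sq; ring. }
  assert (I2 : ((- (Ci * w)) * (- (Ci * w)) = - (w * w))%C).
  { rewrite <- I1; ring. }
  assert (HP : (x ^ 4 - w ^ 4 = (x * x - w * w) * (x * x + w * w))%C) by ring.
  rewrite HP in H |- *. destruct (Cmult_neq0_inv _ _ H) as [H1 H2].
  destruct (Cmult_neq0_inv (x - w) (x - - w)) as [N1 N2]; [now rewrite P1|].
  destruct (Cmult_neq0_inv (x - Ci * w) (x - - (Ci * w))) as [N3 N4]; [now rewrite P2|].
  rewrite I1, I2.
  transitivity ((/ ((x - w) * (x - w)) + / ((x - - w) * (x - - w)))
    + (/ ((x - Ci * w) * (x - Ci * w)) + / ((x - - (Ci * w)) * (x - - (Ci * w)))))%C.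
  { field; repeat split; auto. }
  rewrite (Cinv_sq_sum (x - w) (x - - w)), (Cinv_sq_sum (x - Ci * w)) by assumption.
  rewrite P1, P2, S2. field; auto.
Qed.

(* The power series [sum_(k >= 1) (4k-1) y^k = y(y+3)/(1-y)^2] with its exact remainder. *)
Lemma csum_geom (y : C) (K : nat) :
  ((1 - y) * (1 - y) * csum (fun k => RtoC (4 * INR k + 3) * y ^ S k) K
   = y * (y + 3) - (RtoC (4 * INR K + 3) * y ^ S K - RtoC (4 * INR K - 1) * y ^ S (S K)))%C.
Proof.
  induction K as [|K IH].
  - simpl. replace (4 * 0 + 3) with 3 by ring. replace (4 * 0 - 1) with (-1) by ring.
    apply injective_projections; simpl; ring.
  - change (csum (fun k => RtoC (4 * INR k + 3) * y ^ S k)%C (S K)) with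
     (csum (fun k => RtoC (4 * INR k + 3) * y ^ S k) K + RtoC (4 * INR K + 3) * y ^ S K)%C.
    rewrite Cmult_plus_distr_l, IH. rewrite S_INR.
    rewrite !RtoC_plus, !RtoC_minus, !RtoC_mult, !RtoC_plus, !Cpow_S. ring.
Qed.

Lemma Cmod_one_minus (y : C) : Cmod y <= /2 -> /2 <= Cmod (1 - y).
Proof.
  intros H. assert (T := Cmod_triangle (1 - y) y).
  replace (1 - y + y)%C with (RtoC 1) in T by ring. rewrite Cmod_1 in T. lra.
Qed.

(** The remainder in [csum_geom] has modulus at most 2 (4K + 3) |y|^(K+1), and dividing by (1 - y)^2
    with |1 - y| >= 1/2 costs a factor 4. *)
Lemma csum_geom_remainder (y : C) (K : nat) : Cmod y <= / 2 ->
  Cmod (y * (y + 3) / ((1 - y) * (1 - y)) - csum (fun k => RtoC (4 * INR k + 3) * y ^ S k) K)%C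
  <= 8 * (4 * INR K + 3) * Cmod y ^ S K.
Proof.
  intros Hy. assert (H1 := Cmod_one_minus y Hy).
  assert (N1 : (1 - y)%C <> 0) by (apply Cmod_gt_0; lra).
  assert (E : (y * (y + 3) / ((1 - y) * (1 - y)) - csum (fun k => RtoC (4 * INR k + 3) * y ^ S k) K
    = (RtoC (4 * INR K + 3) * y ^ S K - RtoC (4 * INR K - 1) * y ^ S (S K))
        * / ((1 - y) * (1 - y)))%C).
  { assert (G := csum_geom y K). set (s := csum _ K) in *.
    replace (y * (y + 3))%C with ((1 - y) * (1 - y) * s
      + (RtoC (4 * INR K + 3) * y ^ S K - RtoC (4 * INR K - 1) * y ^ S (S K)))%C
      by (rewrite G; ring).
    generalize (RtoC (4 * INR K + 3) * y ^ S K - RtoC (4 * INR K - 1) * y ^ S (S K))%C.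
    intros d. field. auto. }
  rewrite E, Cmod_mult, Cmod_inv, Cmod_mult by (apply Cmult_neq_0; auto).
  assert (HK := pos_INR K). assert (My := Cmod_ge_0 y).
  assert (Py : 0 <= Cmod y ^ S K) by (apply pow_le; auto).
  assert (B : Cmod (RtoC (4 * INR K + 3) * y ^ S K - RtoC (4 * INR K - 1) * y ^ S (S K))
     <= 2 * ((4 * INR K + 3) * Cmod y ^ S K)).
  { unfold Cminus at 1. eapply Rle_trans; [apply Cmod_triangle|].
    rewrite Cmod_opp, !Cmod_mult, !Cmod_R, !Cmod_pow.
    rewrite (Rabs_pos_eq (4 * INR K + 3)) by lra.
    assert (Rabs (4 * INR K - 1) * Cmod y ^ S (S K) <= (4 * INR K + 3) * Cmod y ^ S K).
    { apply Rmult_le_compat; [apply Rabs_pos|apply pow_le; auto| |].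
      - apply Rabs_le; lra.
      - change (Cmod y ^ S (S K)) with (Cmod y * Cmod y ^ S K).
        rewrite <- (Rmult_1_l (Cmod y ^ S K)) at 2. apply Rmult_le_compat_r; lra. }
    lra. }
  assert (I : / (Cmod (1 - y) * Cmod (1 - y)) <= 4).
  { replace 4 with (/ (/2 * /2)) by field.
    apply Rinv_le_contravar; [lra|]. apply Rmult_le_compat; lra. }
  eapply Rle_trans; [apply Rmult_le_compat; [apply Cmod_ge_0| |exact B|exact I]|lra].
  apply Rlt_le, Rinv_0_lt_compat, Rmult_lt_0_compat; lra.
Qed.

Lemma Re_csum (f : nat -> C) (n : nat) : Re (csum f n) = rsum (fun k => Re (f k)) n.
Proof. apply fst_csum. Qed.

Lemma Re_scal (r : R) (z : C) : Re (RtoC r * z) = r * Re z.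
Proof. unfold Re; simpl; ring. Qed.

Lemma Re_Cminus (z w : C) : Re (z - w) = Re z - Re w.
Proof. unfold Re; simpl; ring. Qed.

Lemma le_Cmod_of_Re (u v : R) : Rabs u <= Cmod (u, v).
Proof. exact (re_le_Cmod (u, v)). Qed.

(** The real part of w alone gives |w| >= om u >= 2x, so x avoids all four turned points and x^4/w^4
    lies well inside the unit disc. *)
Lemma rot_sum_wp_term (om x u v : R) : 0 < om -> 0 < x <= om / 2 -> 1 <= u ->
  let w := lat om u v in
  rot_sum (wp_term om x) u v
  = Re (4 * (RtoC x * RtoC x) * (RtoC x ^ 4 + 3 * w ^ 4)
        / ((RtoC x ^ 4 - w ^ 4) * (RtoC x ^ 4 - w ^ 4)))
  /\ w <> 0 /\ Cmod (RtoC x ^ 4 / w ^ 4) <= / 2.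
Proof.
  intros Hom Hx Hu w.
  assert (Hw : 2 * x <= Cmod w).
  { eapply Rle_trans; [|apply le_Cmod_of_Re]. rewrite Rabs_pos_eq by nra. nra. }
  assert (Hw0 : w <> 0) by (apply Cmod_gt_0; lra).
  assert (Hy : Cmod (RtoC x ^ 4 / w ^ 4) <= / 2).
  { rewrite Cmod_div, !Cmod_pow, Cmod_R, Rabs_pos_eq by (try apply Cpow_nz; auto; lra).
    apply Rmult_le_reg_r with (Cmod w ^ 4); [apply pow_lt; lra|].
    unfold Rdiv; rewrite Rmult_assoc, Rinv_l, Rmult_1_r by (apply pow_nonzero; lra).
    assert ((2 * x) ^ 4 <= Cmod w ^ 4) by (apply pow_incr; lra).
    assert (0 < x ^ 4) by (apply pow_lt; lra).
    rewrite Rpow_mult_distr in H. lra. }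
  split; [|split; auto].
  assert (Hd : (RtoC x ^ 4 - w ^ 4)%C <> 0).
  { intros E. assert (E' : (RtoC x ^ 4 = w ^ 4)%C).
    { replace (RtoC x ^ 4)%C with (RtoC x ^ 4 - w ^ 4 + w ^ 4)%C by ring. rewrite E; ring. }
    rewrite E' in Hy. unfold Cdiv in Hy.
    rewrite Cinv_r, Cmod_1 in Hy by (apply Cpow_nz; auto). lra. }
  rewrite <- (quarter_turn_sum (RtoC x) w Hw0 Hd).
  unfold rot_sum, wp_term.
  assert (Nu : u <> 0) by lra. assert (Nu' : - u <> 0) by lra.
  destruct (Req_EM_T u 0) as [?|_]; [contradiction|].
  destruct (Req_EM_T (- u) 0) as [?|_]; [contradiction|].
  (* At (-v, u) and (v, -u) the first coordinate may vanish, but the second does not, so both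
     branches of the remaining test carry the same term. *)
  assert (T : forall (a b : R) (z z' : C), z = z' ->
     (if Req_EM_T a 0 then Re z else Re z) = Re z') by
     (intros a b z z' ->; destruct (Req_EM_T a 0); reflexivity).
  assert (E1 : lat om (- v) u = (Ci * w)%C) by
    (unfold w, lat, Ci, Cmult; simpl; f_equal; ring).
  assert (E2 : lat om (- u) (- v) = (- w)%C) by
    (unfold w, lat, Copp; simpl; f_equal; ring).
  assert (E3 : lat om v (- u) = (- (Ci * w))%C) by
    (unfold w, lat, Ci, Cmult, Copp; simpl; f_equal; ring).
  rewrite E1, E2, E3. fold w. cbv zeta.
  set (a1 := (/ ((x - w) * (x - w)) - / (w * w))%C).
  set (a2 := (/ ((x - Ci * w) * (x - Ci * w)) - / (Ci * w * (Ci * w)))%C).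
  set (a3 := (/ ((x - - w) * (x - - w)) - / (- w * - w))%C).
  set (a4 := (/ ((x - - (Ci * w)) * (x - - (Ci * w))) - / (- (Ci * w) * - (Ci * w)))%C).
  rewrite !(T _ 0 _ _ eq_refl).
  reflexivity.
Qed.

Definition zeta_pt (A c : nat) : C := (INR A, INR c - INR A).

(** When 4 divides m, all four sides contribute equally, and four times the sum over A is the
    Eisenstein series of weight m of the Gaussian integers. *)
Definition shell_sum (m A : nat) : R := rsum (fun c => Re (/ zeta_pt A c ^ m)) (2 * A).

(** In terms of y = (x/w)^4 the orbit sum is (4/x^2) y(y+3)/(1-y)^2, to which [csum_geom_remainder]
    applies; hence 32 = 4 * 8. Using |w| >= om u makes the bound constant along a side. *)
Lemma rot_sum_wp_expand (om x u v : R) (K : nat) : 0 < om -> 0 < x <= om / 2 -> 1 <= u ->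
  Rabs (rot_sum (wp_term om x) u v
    - rsum (fun k => 4 * (4 * INR k + 3) * x ^ (4 * k + 2) / om ^ (4 * S k)
                     * Re (/ (u, v) ^ (4 * S k))) K)
  <= 32 * (4 * INR K + 3) / om ^ (4 * S K) * x ^ (4 * K + 2) * / u ^ (4 * S K).
Proof.
  intros Hom Hx Hu.
  destruct (rot_sum_wp_term om x u v Hom Hx Hu) as [E [Hw Hy]].
  rewrite E. set (w := lat om u v) in *. clear E.
  set (y := (RtoC x ^ 4 / w ^ 4)%C) in *.
  assert (Nx : RtoC x <> 0) by (intros H; apply RtoC_inj in H; lra).
  assert (Nw4 : (w ^ 4)%C <> 0) by (apply Cpow_nz; auto).
  assert (N1 : (1 - y)%C <> 0).
  { assert (H := Cmod_one_minus y Hy). apply Cmod_gt_0; lra. }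
  assert (Ey : (RtoC x ^ 4 = y * w ^ 4)%C) by (unfold y; field; auto).
  assert (F : (4 * (RtoC x * RtoC x) * (RtoC x ^ 4 + 3 * w ^ 4)
        / ((RtoC x ^ 4 - w ^ 4) * (RtoC x ^ 4 - w ^ 4))
     = RtoC (4 / x ^ 2) * (y * (y + 3) / ((1 - y) * (1 - y))))%C).
  { replace (RtoC (4 / x ^ 2)) with (4 * (RtoC x * RtoC x) / RtoC x ^ 4)%C.
    2:{ rewrite RtoC_div by (apply pow_nonzero; lra). rewrite RtoC_pow. field. auto. }
    rewrite Ey. replace (y * w ^ 4 - w ^ 4)%C with (- ((1 - y) * w ^ 4))%C by ring.
    assert (y <> 0).
    { unfold y. apply Cmult_neq_0; [apply Cpow_nz; auto|]. 
      intros H. apply (C1_nz). rewrite <- (Cinv_r (w ^ 4)%C), H by auto. ring. }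
    field. repeat split; auto. }
  rewrite F.
  rewrite (rsum_ext _ (fun k => Re (RtoC (4 / x ^ 2) * (RtoC (4 * INR k + 3) * y ^ S k)))).
  2:{ intros k _.
      replace (y ^ S k)%C with (RtoC (x ^ (4 * S k) / om ^ (4 * S k)) * / (u, v) ^ (4 * S k))%C.
      - rewrite !Re_scal.
        replace (4 * S k)%nat with (4 * k + 2 + 2)%nat by lia.
        rewrite (pow_add x (4 * k + 2) 2). field. repeat split; try apply pow_nonzero; lra.
      - unfold y. assert (Ew : w = (RtoC om * (u, v))%C) by
          (unfold w, lat, Cmult; simpl; f_equal; ring).
        assert (Nuv : ((u, v) : C) <> 0) by (intros H; apply (f_equal fst) in H; simpl in H; lra).
        assert (Nom : RtoC om <> 0) by (intros H; apply RtoC_inj in H; lra).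
        rewrite RtoC_div, !RtoC_pow by (apply pow_nonzero; lra).
        unfold Cdiv. rewrite Cpow_mult_l, Cpow_inv by auto.
        rewrite <- !Cpow_mult_r. rewrite Ew, Cpow_mult_l. field.
        split; apply Cpow_nz; auto. }
  assert (D : Re (RtoC (4 / x ^ 2) * (y * (y + 3) / ((1 - y) * (1 - y))))
      - rsum (fun k => Re (RtoC (4 / x ^ 2) * (RtoC (4 * INR k + 3) * y ^ S k))) K
      = 4 / x ^ 2 * Re (y * (y + 3) / ((1 - y) * (1 - y))
          - csum (fun k => RtoC (4 * INR k + 3) * y ^ S k) K)%C).
  { rewrite Re_Cminus, Re_csum, Re_scal.
    rewrite (rsum_ext _ (fun k => 4 / x ^ 2 * Re (RtoC (4 * INR k + 3) * y ^ S k))).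
    - rewrite rsum_scal; ring.
    - intros k _; apply Re_scal. }
  rewrite D, Rabs_mult.
  assert (Hx2 : 0 < 4 / x ^ 2) by (apply Rdiv_lt_0_compat; [lra|apply pow_lt; lra]).
  rewrite (Rabs_pos_eq (4 / x ^ 2)) by lra.
  assert (B : Rabs (Re (y * (y + 3) / ((1 - y) * (1 - y))
          - csum (fun k => RtoC (4 * INR k + 3) * y ^ S k) K)%C)
          <= 8 * (4 * INR K + 3) * Cmod y ^ S K).
  { eapply Rle_trans; [apply re_le_Cmod|]. apply csum_geom_remainder; auto. }
  assert (By : Cmod y ^ S K <= x ^ (4 * S K) / om ^ (4 * S K) * / u ^ (4 * S K)).
  { assert (0 < om * u) by nra.
    replace (x ^ (4 * S K) / om ^ (4 * S K) * / u ^ (4 * S K)) with ((x ^ 4 / (om * u) ^ 4) ^ S K).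
    - apply pow_incr; split; [apply Cmod_ge_0|].
      unfold y. rewrite Cmod_div, !Cmod_pow, Cmod_R, Rabs_pos_eq by (auto; lra).
      apply Rmult_le_compat_l; [apply pow_le; lra|].
      apply Rinv_le_contravar; [apply pow_lt; lra|].
      apply pow_incr; split; [lra|].
      eapply Rle_trans; [|apply le_Cmod_of_Re]. rewrite Rabs_pos_eq; lra.
    - unfold Rdiv. rewrite Rpow_mult_distr, pow_inv, <- !pow_mult, Rpow_mult_distr.
      field. split; apply pow_nonzero; lra. }
  assert (HK := pos_INR K).
  eapply Rle_trans.
  { apply Rmult_le_compat_l; [lra|]. eapply Rle_trans; [exact B|].
    apply Rmult_le_compat_l; [lra|exact By]. }
  right. replace (4 * S K)%nat with (4 * K + 2 + 2)%nat by lia.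
  rewrite (pow_add x (4 * K + 2) 2). field.
  repeat split; try apply pow_nonzero; lra.
Qed.

(** * Laurent coefficients *)

Lemma rsum_sum_n (f : nat -> R) (N : nat) : rsum f (S N) = sum_n f N.
Proof.
  induction N as [|N IH].
  - rewrite sum_O; simpl; lra.
  - rewrite sum_Sn, <- IH. reflexivity.
Qed.

Lemma is_lim_seq_inv_INR_add (k : nat) : is_lim_seq (fun n => / INR (n + k)) 0.
Proof.
  apply (is_lim_seq_incr_n (fun n => / INR n) k).
  apply (is_lim_seq_inv INR p_infty); [apply is_lim_seq_INR|discriminate].
Qed.

(** The left side bounds 2A points of modulus at least A with exponent 4. It equals 2/A^3, which is
    at most 4/(A(A+1)) because A + 1 <= 2A^2. *)
Lemma inv_cube_telescope (A : nat) : (1 <= A)%nat ->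
  2 * INR A * / INR A ^ 4 <= 4 / INR A - 4 / INR (S A).
Proof.
  intros HA. apply le_INR in HA; simpl in HA. rewrite S_INR. set (a := INR A) in *.
  apply Rmult_le_reg_r with (a ^ 3 * (a + 1)).
  { apply Rmult_lt_0_compat; [apply pow_lt; lra|lra]. }
  replace (2 * a * / a ^ 4 * (a ^ 3 * (a + 1))) with (2 * (a + 1)) by (field; lra).
  replace ((4 / a - 4 / (a + 1)) * (a ^ 3 * (a + 1))) with (4 * (a * a)) by (field; lra).
  nra.
Qed.

Lemma rsum_inv_cube_le (N : nat) :
  rsum (fun A => 2 * INR A * / INR A ^ 4) (S N) <= 4 - 4 / INR (S N).
Proof.
  induction N as [|N IH]; [simpl; lra|].
  change (rsum (fun A => 2 * INR A * / INR A ^ 4) (S (S N))) with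
   (rsum (fun A => 2 * INR A * / INR A ^ 4) (S N) + 2 * INR (S N) * / INR (S N) ^ 4).
  assert (H := inv_cube_telescope (S N) ltac:(lia)). lra.
Qed.

Lemma Rinv_pow_antitone (a : R) (p q : nat) : 1 <= a -> (p <= q)%nat -> / a ^ q <= / a ^ p.
Proof.
  intros Ha Hpq. apply Rinv_le_contravar; [apply pow_lt; lra|]. apply Rle_pow; auto.
Qed.

Lemma Rabs_shell_sum (m A : nat) : (4 <= m)%nat ->
  Rabs (shell_sum m A) <= 2 * INR A * / INR A ^ 4.
Proof.
  intros Hm. destruct A as [|A].
  { unfold shell_sum; simpl. rewrite Rabs_R0. lra. }
  set (B := S A).
  assert (HB : 1 <= INR B) by (change 1 with (INR 1); apply le_INR; unfold B; lia).
  unfold shell_sum.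
  eapply Rle_trans; [apply (Rabs_rsum_le _ (fun _ => / INR B ^ 4))|].
  - intros c _. eapply Rle_trans; [apply re_le_Cmod|].
    assert (Hz : INR B <= Cmod (zeta_pt B c)).
    { eapply Rle_trans; [|apply le_Cmod_of_Re]. rewrite Rabs_pos_eq; lra. }
    rewrite Cmod_inv, Cmod_pow by (apply Cpow_nz, Cmod_gt_0; lra).
    eapply Rle_trans; [|apply (Rinv_pow_antitone _ 4 m HB Hm)].
    apply Rinv_le_contravar; [apply pow_lt; lra|]. apply pow_incr; lra.
  - rewrite rsum_const, mult_INR. simpl (INR 2). right; ring.
Qed.

Lemma shell_sum_cvg (m : nat) : (4 <= m)%nat ->
  is_lim_seq (fun N => rsum (shell_sum m) (S N)) (Series (shell_sum m)).
Proof.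
  intros Hm.
  assert (E : ex_series (shell_sum m)).
  (* The telescoping majorant is available only from radius 1 on. *)
  { apply ex_series_incr_1.
    apply (@ex_series_le R_AbsRing R_CompleteNormedModule _ (fun A => 4 / INR (S A) - 4 / INR (S (S A)))).
    - intros A. eapply Rle_trans; [apply Rabs_shell_sum, Hm|].
      apply inv_cube_telescope; lia.
    - exists 4. change (is_lim_seq (sum_n (fun A => 4 / INR (S A) - 4 / INR (S (S A)))) 4).
      apply is_lim_seq_ext with (fun N => 4 - 4 * / INR (S (S N))).
      + induction n as [|n IH].
        * rewrite sum_O. simpl. lra.
        * rewrite sum_Sn, <- IH.
          match goal with |- _ = plus ?u ?v => change (plus u v) with (u + v) end.
          unfold Rdiv. ring.
      + replace (Finite 4) with (Finite (4 - 4 * 0)) by (f_equal; ring).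
        apply is_lim_seq_minus'; [apply is_lim_seq_const|].
        apply is_lim_seq_mult'; [apply is_lim_seq_const|].
        apply is_lim_seq_ext with (2 := is_lim_seq_inv_INR_add 2).
        intros n; rewrite Nat.add_comm; reflexivity. }
  apply is_lim_seq_ext with (sum_n (shell_sum m)).
  - intros N; symmetry; apply rsum_sum_n.
  - apply Series_correct, E.
Qed.

(** The bound is free of N, so it survives the passage to the full lattice. The constant is 128 = 32
    * 4, where 4 bounds the sum over all spheres of 2A/A^4. *)
Lemma wp_partial_expand (om x : R) (K N : nat) : 0 < om -> 0 < x <= om / 2 ->
  Rabs (fst (wp_partial om (x, 0) N) - / x ^ 2
    - rsum (fun k => 4 * (4 * INR k + 3) / om ^ (4 * S k) * rsum (shell_sum (4 * S k)) (S N)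
                     * x ^ (4 * k + 2)) K)
  <= 128 * (4 * INR K + 3) / om ^ (4 * S K) * x ^ (4 * K + 2).
Proof.
  intros Hom Hx.
  rewrite Re_wp_partial by lra.
  rewrite box_sum_shells.
  2:{ unfold wp_term. destruct (Req_EM_T 0 0); [reflexivity|contradiction]. }
  set (c := fun k => 4 * (4 * INR k + 3) * x ^ (4 * k + 2) / om ^ (4 * S k)).
  set (D := 32 * (4 * INR K + 3) / om ^ (4 * S K) * x ^ (4 * K + 2)).
  assert (HD : 0 <= D).
  { assert (H := pos_INR K). unfold D. apply Rmult_le_pos; [|apply pow_le; lra].
    apply Rmult_le_pos; [lra|]. apply Rlt_le, Rinv_0_lt_compat, pow_lt; lra. }
  assert (E : rsum (fun k => 4 * (4 * INR k + 3) / om ^ (4 * S k)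
                 * rsum (shell_sum (4 * S k)) (S N) * x ^ (4 * k + 2)) K
    = rsum (fun A => rsum (fun d => rsum (fun k => c k * Re (/ zeta_pt A d ^ (4 * S k))) K)
                       (2 * A)) (S N)).
  { rewrite (rsum_ext _ (fun k => rsum (fun A => c k * shell_sum (4 * S k) A) (S N))).
    - rewrite rsum_exchange. apply rsum_ext; intros A _.
      rewrite <- rsum_exchange. apply rsum_ext; intros k _. symmetry; apply rsum_scal.
    - intros k _. rewrite rsum_scal. unfold c, Rdiv. ring. }
  rewrite E.
  replace (/ x ^ 2 + _ - / x ^ 2 - _) with
   (rsum (fun A => rsum (fun d => rot_sum (wp_term om x) (INR A) (INR d - INR A)
       - rsum (fun k => c k * Re (/ zeta_pt A d ^ (4 * S k))) K) (2 * A)) (S N)).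
  2:{ rewrite (rsum_ext _ _ _ (fun A _ => rsum_minus _ _ _)), rsum_minus. ring. }
  eapply Rle_trans.
  - apply (Rabs_rsum_le _ (fun A => D * (2 * INR A * / INR A ^ 4))). intros A _.
    eapply Rle_trans; [apply (Rabs_rsum_le _ (fun _ => D * / INR A ^ 4))|].
    + intros d Hd. assert (HA : 1 <= INR A).
      { change 1 with (INR 1); apply le_INR; lia. }
      eapply Rle_trans; [apply (rot_sum_wp_expand om x (INR A) (INR d - INR A) K Hom Hx HA)|].
      apply Rmult_le_compat_l; [exact HD|]. apply Rinv_pow_antitone; [auto|lia].
    + rewrite rsum_const, mult_INR. simpl (INR 2). right; ring.
  - rewrite rsum_scal.
    assert (H := rsum_inv_cube_le N).
    assert (0 < 4 / INR (S N)) by (apply Rdiv_lt_0_compat; [lra|apply lt_0_INR; lia]).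
    replace (128 * (4 * INR K + 3) / om ^ (4 * S K) * x ^ (4 * K + 2)) with (D * 4)
      by (unfold D, Rdiv; ring).
    apply Rmult_le_compat_l; lra.
Qed.

(** Letting x tend to 0 from the right identifies the constant coefficient; subtracting it and
    dividing by x gives the same hypothesis for the shifted sequences with J lowered by one. *)
Lemma PSeries_coef_unique (J : nat) : forall (a c : nat -> R) (M d : R),
  0 < d -> Rbar_lt 0 (CV_radius a) ->
  (forall x, 0 < x < d ->
     Rabs (PSeries a x - rsum (fun j => c j * x ^ j) J) <= M * x ^ J) ->
  forall j, (j < J)%nat -> a j = c j.
Proof.
  induction J as [|J IH]; intros a c M d Hd Ha H j Hj; [lia|].
  assert (H0 : a 0%nat = c 0%nat).
  (* For 0 < x < 1, both the error term and every summand after the first carry a factor x. *)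
  { set (L := Rabs M + rsum (fun j => Rabs (c (S j))) J).
    assert (HL : forall x, 0 < x < Rmin d 1 -> Rabs (PSeries a x - c 0%nat) <= L * x).
    { intros x Hx. assert (x < d) by (apply Rlt_le_trans with (1 := proj2 Hx), Rmin_l).
      assert (x < 1) by (apply Rlt_le_trans with (1 := proj2 Hx), Rmin_r).
      assert (P : forall k, x ^ k <= 1).
      { intros k. rewrite <- (pow1 k). apply pow_incr; lra. }
      replace (PSeries a x - c 0%nat) with
        ((PSeries a x - rsum (fun j => c j * x ^ j) (S J))
          + x * rsum (fun j => c (S j) * x ^ j) J).
      2:{ rewrite rsum_first, <- rsum_scal.
          rewrite (rsum_ext (fun k => c (S k) * x ^ S k) (fun k => x * (c (S k) * x ^ k)))
            by (intros; simpl; ring). simpl; ring. }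
      eapply Rle_trans; [apply Rabs_triang|]. unfold L. rewrite Rmult_plus_distr_r.
      apply Rplus_le_compat.
      - eapply Rle_trans; [apply H; lra|].
        assert (T1 := P J). assert (0 <= x ^ J) by (apply pow_le; lra).
        assert (T2 := Rle_abs M). assert (T3 := Rabs_pos M).
        apply Rle_trans with (Rabs M * x ^ S J).
        + apply Rmult_le_compat_r; [apply pow_le; lra|auto].
        + apply Rmult_le_compat_l; auto. simpl. nra.
      - rewrite Rabs_mult, Rabs_pos_eq, Rmult_comm by lra.
        apply Rmult_le_compat_r; [lra|]. apply Rabs_rsum_le; intros k _.
        rewrite Rabs_mult. rewrite (Rabs_pos_eq (x ^ k)) by (apply pow_le; lra).
        assert (T1 := P k). assert (T2 := Rabs_pos (c (S k))). nra. }
    set (m := Rmin d 1) in *. assert (Hm : 0 < m) by (apply Rmin_glb_lt; lra).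
    set (x := fun n => m * / INR (S (S n))).
    assert (Lx : is_lim_seq x 0).
    { replace (Finite 0) with (Finite (m * 0)) by (f_equal; ring).
      apply is_lim_seq_mult'; [apply is_lim_seq_const|].
      apply is_lim_seq_ext with (2 := is_lim_seq_inv_INR_add 2).
      intros n; rewrite Nat.add_comm; reflexivity. }
    assert (Hx : forall n, 0 < x n < m).
    { intros n. assert (1 < INR (S (S n))) by (change 1 with (INR 1); apply lt_INR; lia).
      assert (0 < / INR (S (S n)) < 1).
      { split; [apply Rinv_0_lt_compat; lra|]. rewrite <- Rinv_1.
        apply Rinv_lt_contravar; lra. }
      unfold x; nra. }
    assert (L1 : is_lim_seq (fun n => PSeries a (x n) - c 0%nat) (a 0%nat - c 0%nat)).
    { apply is_lim_seq_minus'; [|apply is_lim_seq_const].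
      rewrite <- (PSeries_0 a). apply is_lim_seq_continuous; [|exact Lx].
      apply PSeries_continuity. rewrite Rabs_R0. exact Ha. }
    assert (L2 : is_lim_seq (fun n => PSeries a (x n) - c 0%nat) 0).
    { apply is_lim_seq_abs_0.
      apply is_lim_seq_le_le with (fun _ => 0) (fun n => L * x n).
      - intros n; split; [apply Rabs_pos|apply HL, Hx].
      - apply is_lim_seq_const.
      - replace (Finite 0) with (Finite (L * 0)) by (f_equal; ring).
        apply is_lim_seq_mult'; [apply is_lim_seq_const|exact Lx]. }
    apply is_lim_seq_unique in L1. apply is_lim_seq_unique in L2.
    rewrite L1 in L2. injection L2; lra. }
  destruct j as [|j]; [exact H0|].
  assert (Q : Rbar_lt 0 (CV_radius (PS_decr_1 a))) by (rewrite CV_radius_decr_1; exact Ha).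
  (* Splitting off the first term by [PSeries_decr_1] requires convergence at x, hence the smaller
     interval. *)
  assert (exists d', 0 < d' /\ d' <= d /\ Rbar_le d' (CV_radius a)) as [d' [Hd' [Hdd Hr]]].
  { destruct (CV_radius a) as [ra| |]; simpl in Ha.
    - exists (Rmin d ra). repeat split; [apply Rmin_glb_lt; lra|apply Rmin_l|apply Rmin_r].
    - exists d. repeat split; simpl; auto; lra.
    - contradiction. }
  apply (IH (PS_decr_1 a) (fun j => c (S j)) M d' Hd' Q); [|lia].
  intros x Hx. apply Rmult_le_reg_l with x; [lra|].
  rewrite <- (Rabs_pos_eq x) at 1 by lra. rewrite <- Rabs_mult.
  replace (x * (M * x ^ J)) with (M * x ^ S J) by (simpl; ring).
  replace (x * (PSeries (PS_decr_1 a) x - rsum (fun j => c (S j) * x ^ j) J))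
    with (PSeries a x - rsum (fun j => c j * x ^ j) (S J)).
  - apply H; lra.
  - rewrite rsum_first, PSeries_decr_1.
    + rewrite H0.
      rewrite (rsum_ext (fun k => c (S k) * x ^ S k) (fun k => x * (c (S k) * x ^ k)))
        by (intros; simpl; ring). rewrite rsum_scal. simpl; ring.
    + apply CV_radius_inside. rewrite Rabs_pos_eq by lra.
      eapply Rbar_lt_le_trans; [|exact Hr]. simpl; lra.
Qed.

Lemma CV_radius_pos_of_ex_pseries (a : nat -> R) (x : R) :
  x <> 0 -> ex_pseries a x -> Rbar_lt 0 (CV_radius a).
Proof.
  intros Hx He. apply Rbar_not_le_lt. intros Hle.
  apply (CV_disk_outside a x).
  - eapply Rbar_le_lt_trans; [exact Hle|]. simpl. apply Rabs_pos_lt, Hx.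
  - apply ex_series_lim_0. apply ex_pseries_R. exact He.
Qed.

(** The length 4K + 2 is the exponent of the first omitted power, so that the error in
    [wp_partial_expand] has exactly the order that [PSeries_coef_unique] asks for. *)
Lemma rsum_sparse (c : nat -> R) (x : R) (K : nat) :
  rsum (fun j => (if (j mod 4 =? 2)%nat then c (j / 4)%nat else 0) * x ^ j) (4 * K + 2)
  = rsum (fun k => c k * x ^ (4 * k + 2)) K.
Proof.
  induction K as [|K IH]; [simpl; ring|].
  replace (4 * S K + 2)%nat with (S (S (S (S (4 * K + 2))))) by lia.
  set (f := fun j => _) in *.
  change (rsum f (S (S (S (S (4 * K + 2)))))) with
   (rsum f (4 * K + 2) + f (4 * K + 2)%nat + f (S (4 * K + 2)) + f (S (S (4 * K + 2)))
    + f (S (S (S (4 * K + 2))))).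
  rewrite IH. change (rsum (fun k => c k * x ^ (4 * k + 2)) (S K)) with
   (rsum (fun k => c k * x ^ (4 * k + 2)) K + c K * x ^ (4 * K + 2)).
  assert (M : forall i, (i < 4)%nat -> ((i + K * 4) mod 4 = i)%nat).
  { intros i Hi. rewrite Nat.Div0.mod_add. apply Nat.mod_small; auto. }
  unfold f.
  replace (S (S (S (4 * K + 2)))) with (1 + S K * 4)%nat by lia.
  replace (S (S (4 * K + 2))) with (0 + S K * 4)%nat by lia.
  replace (S (4 * K + 2)) with (3 + K * 4)%nat by lia.
  replace (4 * K + 2)%nat with (2 + K * 4)%nat by lia.
  rewrite !Nat.Div0.mod_add, Nat.div_add by lia. simpl Nat.modulo. simpl Nat.eqb.
  change (2 / 4)%nat with 0%nat. simpl (0 + K)%nat. cbv iota. ring.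
Qed.

(** For fixed x, letting N tend to infinity in [wp_partial_expand] bounds the Taylor remainder of
    the regular part of the Weierstrass function, which determines its coefficients. *)
Lemma laurent_coef (om : R) (a : nat -> R) (r : R) : 0 < om -> 0 < r ->
  (forall x, 0 < Rabs x < r -> exists s, Pser a x s /\ is_wp om (x, 0) (/ x ^ 2 + s, 0)) ->
  forall k, a (4 * k + 2)%nat = 4 * (4 * INR k + 3) / om ^ (4 * S k) * Series (shell_sum (4 * S k)).
Proof.
  intros Hom Hr H k.
  set (c := fun k => 4 * (4 * INR k + 3) / om ^ (4 * S k) * Series (shell_sum (4 * S k))).
  set (b := fun j => if (j mod 4 =? 2)%nat then c (j / 4)%nat else 0).
  replace (4 * (4 * INR k + 3) / om ^ (4 * S k) * Series (shell_sum (4 * S k)))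
    with (b (4 * k + 2)%nat).
  2:{ unfold b. replace (4 * k + 2)%nat with (2 + k * 4)%nat by lia.
      rewrite Nat.Div0.mod_add, Nat.div_add by lia. reflexivity. }
  (* Truncating after [S k] sparse terms brings the index 4k + 2 into the compared range. *)
  apply (PSeries_coef_unique (4 * S k + 2) a b
    (128 * (4 * INR (S k) + 3) / om ^ (4 * S (S k))) (Rmin r (om / 2))); [| | |lia].
  - apply Rmin_glb_lt; lra.
  - apply (CV_radius_pos_of_ex_pseries a (r / 2)); [lra|].
    destruct (H (r / 2)) as [s [Hs _]]; [rewrite Rabs_pos_eq; lra|].
    exists s. apply is_pseries_Reals, Hs.
  - intros x Hx.
    assert (x < r) by (apply Rlt_le_trans with (1 := proj2 Hx), Rmin_l).
    assert (x < om / 2) by (apply Rlt_le_trans with (1 := proj2 Hx), Rmin_r).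
    destruct (H x) as [s [Hs [Hw _]]]; [rewrite Rabs_pos_eq; lra|]. simpl fst in Hw.
    apply is_pseries_Reals, is_pseries_unique in Hs. rewrite Hs.
    unfold b. rewrite rsum_sparse.
    apply is_lim_seq_Reals in Hw.
    assert (L : is_lim_seq (fun N => Rabs (fst (wp_partial om (x, 0) N) - / x ^ 2
      - rsum (fun k => 4 * (4 * INR k + 3) / om ^ (4 * S k) * rsum (shell_sum (4 * S k)) (S N)
                     * x ^ (4 * k + 2)) (S k)))
      (Rabs (/ x ^ 2 + s - / x ^ 2 - rsum (fun k => c k * x ^ (4 * k + 2)) (S k)))).
    { apply (is_lim_seq_abs _ (Finite _)). apply is_lim_seq_minus'.
      - apply is_lim_seq_minus'; [exact Hw|apply is_lim_seq_const].
      - apply (is_lim_seq_rsum (fun N k => 4 * (4 * INR k + 3) / om ^ (4 * S k) * rsum (shell_sum (4 * S k)) (S N)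
                     * x ^ (4 * k + 2))). intros i _. unfold c.
        apply is_lim_seq_mult'; [|apply is_lim_seq_const].
        apply is_lim_seq_mult'; [apply is_lim_seq_const|].
        apply shell_sum_cvg; lia. }
    replace (s - rsum (fun k => c k * x ^ (4 * k + 2)) (S k)) with
      (/ x ^ 2 + s - / x ^ 2 - rsum (fun k => c k * x ^ (4 * k + 2)) (S k)) by ring.
    refine (is_lim_seq_le _ _ (Finite _) (Finite _) _ L (is_lim_seq_const _)).
    intros N. apply wp_partial_expand; lra.
Qed.

(** * Integrals over the half-line *)

(** A certificate that f integrates to l over the half-line: a primitive vanishing at infinity. It
    is closed under linear combinations without any epsilon argument, and it yields the integral
    over every [a, b] as F b - F a. *)
Definition primitive_0_inf (f : R -> R) (l : R) : Prop :=
  (forall t, continuous f t) /\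
  exists F : R -> R, (forall t, is_derive F t (f t)) /\ F 0 = - l /\ is_lim F p_infty 0.

Lemma primitive_0_inf_ext (f g : R -> R) (l : R) :
  (forall t, f t = g t) -> primitive_0_inf f l -> primitive_0_inf g l.
Proof.
  intros E [Hc [F [HF [H0 HL]]]]. split.
  - intros t. apply continuous_ext with f; auto.
  - exists F. split; auto. intros t. rewrite <- E. auto.
Qed.

Lemma primitive_0_inf_scal (c : R) (f : R -> R) (l : R) :
  primitive_0_inf f l -> primitive_0_inf (fun t => c * f t) (c * l).
Proof.
  intros [Hc [F [HF [H0 HL]]]]. split.
  - intros t. apply (continuous_scal_r c f t (Hc t)).
  - exists (fun t => c * F t). split; [|split].
    + intros t. apply (is_derive_scal F t c (f t) (HF t)).
    + rewrite H0; ring.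
    + replace (Finite 0) with (Rbar_mult c 0) by (simpl; f_equal; ring).
      apply is_lim_scal_l, HL.
Qed.

Lemma primitive_0_inf_plus (f g : R -> R) (l m : R) :
  primitive_0_inf f l -> primitive_0_inf g m ->
  primitive_0_inf (fun t => f t + g t) (l + m).
Proof.
  intros [Hc [F [HF [H0 HL]]]] [Kc [G [HG [K0 KL]]]]. split.
  - intros t. apply (continuous_plus f g t (Hc t) (Kc t)).
  - exists (fun t => F t + G t). split; [|split].
    + intros t. apply (is_derive_plus F G t (f t) (g t) (HF t) (HG t)).
    + rewrite H0, K0; ring.
    + replace (Finite 0) with (Finite (0 + 0)) by (f_equal; ring).
      apply is_lim_plus'; auto.
Qed.

Lemma primitive_0_inf_0 : primitive_0_inf (fun _ => 0) 0.
Proof.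
  split; [intros t; apply continuous_const|].
  exists (fun _ => 0). split; [|split; [ring|apply is_lim_const]].
  intros t. apply (is_derive_const 0).
Qed.

Lemma primitive_0_inf_rsum (f : nat -> R -> R) (l : nat -> R) (n : nat) :
  (forall k, (k < n)%nat -> primitive_0_inf (f k) (l k)) ->
  primitive_0_inf (fun t => rsum (fun k => f k t) n) (rsum l n).
Proof.
  induction n as [|n IH]; intros H; simpl; [apply primitive_0_inf_0|].
  apply primitive_0_inf_plus; auto with arith.
Qed.

(** Each factor t consumes half of the decay rate: t e^(-at/2) <= 2/a because e^s >= s. *)
Lemma pow_exp_bounded (j : nat) : forall a, 0 < a ->
  exists M, 0 <= M /\ forall t, 0 <= t -> t ^ j * exp (- a * t) <= M.
Proof.
  induction j as [|j IH]; intros a Ha.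
  - exists 1. split; [lra|]. intros t Ht. simpl. rewrite Rmult_1_l, <- exp_0.
    destruct (Req_dec (- a * t) 0) as [->|H]; [lra|].
    apply Rlt_le, exp_increasing. nra.
  - destruct (IH (a / 2)) as [M [HM B]]; [lra|].
    exists (2 / a * M). split.
    { apply Rmult_le_pos; auto. apply Rlt_le, Rdiv_lt_0_compat; lra. }
    intros t Ht.
    replace (exp (- a * t)) with (exp (- (a / 2) * t) * exp (- (a / 2) * t))
      by (rewrite <- exp_plus; f_equal; field).
    replace (t ^ S j * _) with ((t * exp (- (a / 2) * t)) * (t ^ j * exp (- (a / 2) * t)))
      by (simpl; ring).
    apply Rmult_le_compat; auto.
    + apply Rmult_le_pos; auto. apply Rlt_le, exp_pos.
    + apply Rmult_le_pos; [apply pow_le; auto|]. apply Rlt_le, exp_pos.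
    + replace (- (a / 2) * t) with (- (a / 2 * t)) by ring. rewrite exp_Ropp.
      assert (E := exp_ineq1_le (a / 2 * t)).
      apply Rmult_le_reg_r with (exp (a / 2 * t)); [apply exp_pos|].
      rewrite Rmult_assoc, Rinv_l, Rmult_1_r by (apply Rgt_not_eq, exp_pos).
      apply Rle_trans with (2 / a * (a / 2 * t)); [right; field; lra|].
      apply Rmult_le_compat_l; [apply Rlt_le, Rdiv_lt_0_compat; lra|lra].
Qed.

Lemma is_lim_pow_exp (j : nat) (a : R) (g : R -> R) : 0 < a ->
  (forall t, Rabs (g t) <= 1) ->
  is_lim (fun t => t ^ j * (exp (- a * t) * g t)) p_infty 0.
Proof.
  intros Ha Hg. destruct (pow_exp_bounded j (a / 2)) as [M [HM B]]; [lra|].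
  (* Half of the rate bounds t^j and the other half gives the limit; the [+ 0] is the affine shape
     expected by [is_lim_comp_lin]. *)
  assert (L : is_lim (fun t => M * exp (- (a / 2) * t + 0)) p_infty 0).
  { replace (Finite 0) with (Rbar_mult M 0) by (simpl; f_equal; ring).
    apply is_lim_scal_l, is_lim_comp_lin; [|lra].
    replace (Rbar_plus (Rbar_mult (- (a / 2)) p_infty) 0) with m_infty; [apply is_lim_exp_m|].
    simpl. destruct (Rle_dec 0 (- (a / 2))); [exfalso; lra|reflexivity]. }
  apply (is_lim_le_le_loc (fun t => - (M * exp (- (a / 2) * t + 0)))
           (fun t => M * exp (- (a / 2) * t + 0))).
  - exists 0. intros t Ht.
    assert (Q : Rabs (t ^ j * (exp (- a * t) * g t)) <= M * exp (- (a / 2) * t + 0)).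
    { replace (exp (- a * t)) with (exp (- (a / 2) * t) * exp (- (a / 2) * t + 0))
        by (rewrite <- exp_plus; f_equal; field).
      rewrite !Rabs_mult, !(Rabs_pos_eq (exp _)) by (apply Rlt_le, exp_pos).
      rewrite Rabs_pos_eq by (apply pow_le; lra).
      assert (P := exp_pos (- (a / 2) * t + 0)). assert (B' := B t (Rlt_le _ _ Ht)).
      assert (G := Hg t). assert (P2 := Rabs_pos (g t)).
      replace (t ^ j * _) with
        ((t ^ j * exp (- (a / 2) * t)) * (exp (- (a / 2) * t + 0) * Rabs (g t))) by ring.
      apply Rmult_le_compat; auto; [|nra|nra].
      apply Rmult_le_pos; [apply pow_le; lra|apply Rlt_le, exp_pos]. }
    apply Rabs_le_between in Q. lra.
  - replace (Finite 0) with (Rbar_opp 0) by (simpl; f_equal; ring).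
    apply is_lim_opp, L.
  - exact L.
Qed.

Lemma Rabs_cos_le_1 (x : R) : Rabs (cos x) <= 1.
Proof. apply Rabs_le, COS_bound. Qed.

Lemma Rabs_sin_le_1 (x : R) : Rabs (sin x) <= 1.
Proof. apply Rabs_le, SIN_bound. Qed.

(** With z = a + ib, this is the real part of t^j e^(-zt); [damped_sin] is minus its imaginary
    part. *)
Definition damped_cos (a b : R) (j : nat) (t : R) : R := t ^ j * (exp (- a * t) * cos (b * t)).
Definition damped_sin (a b : R) (j : nat) (t : R) : R := t ^ j * (exp (- a * t) * sin (b * t)).

Lemma is_derive_damped_cos (a b : R) (j : nat) (t : R) :
  is_derive (damped_cos a b j) t
    (INR j * damped_cos a b (pred j) t - a * damped_cos a b j t - b * damped_sin a b j t).
Proof. unfold damped_cos, damped_sin. auto_derive; [auto|ring]. Qed.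

Lemma is_derive_damped_sin (a b : R) (j : nat) (t : R) :
  is_derive (damped_sin a b j) t
    (INR j * damped_sin a b (pred j) t - a * damped_sin a b j t + b * damped_cos a b j t).
Proof. unfold damped_cos, damped_sin. auto_derive; [auto|ring]. Qed.

Lemma continuous_damped_cos (a b : R) (j : nat) (t : R) : continuous (damped_cos a b j) t.
Proof.
  apply (ex_derive_continuous (damped_cos a b j) t). eexists. apply is_derive_damped_cos.
Qed.

Lemma continuous_damped_sin (a b : R) (j : nat) (t : R) : continuous (damped_sin a b j) t.
Proof.
  apply (ex_derive_continuous (damped_sin a b j) t). eexists. apply is_derive_damped_sin.
Qed.

(** The value is minus the boundary term at 0. As [0 ^ j] is 1 for j = 0 and 0 afterwards, one
    recursion covers both cases. *)
Lemma primitive_derive_damped_cos (a b : R) (j : nat) : 0 < a ->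
  primitive_0_inf
    (fun t => INR j * damped_cos a b (pred j) t + (- a * damped_cos a b j t + - b * damped_sin a b j t))
    (- (0 ^ j)).
Proof.
  intros Ha. split.
  - intros t. repeat apply @continuous_plus;
    apply (continuous_scal_r _ (_ : R -> R) t); auto using continuous_damped_cos, continuous_damped_sin.
  - exists (damped_cos a b j). split; [|split].
    + intros t.
      replace (_ + _) with (INR j * damped_cos a b (pred j) t - a * damped_cos a b j t
         - b * damped_sin a b j t) by ring.
      apply is_derive_damped_cos.
    + unfold damped_cos. rewrite !Rmult_0_r, exp_0, cos_0. ring.
    + apply is_lim_pow_exp; auto. intros; apply Rabs_cos_le_1.
Qed.

Lemma primitive_derive_damped_sin (a b : R) (j : nat) : 0 < a ->
  primitive_0_inf
    (fun t => INR j * damped_sin a b (pred j) t + (- a * damped_sin a b j t + b * damped_cos a b j t))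
    0.
Proof.
  intros Ha. split.
  - intros t. repeat apply @continuous_plus;
    apply (continuous_scal_r _ (_ : R -> R) t); auto using continuous_damped_cos, continuous_damped_sin.
  - exists (damped_sin a b j). split; [|split].
    + intros t.
      replace (_ + _) with (INR j * damped_sin a b (pred j) t - a * damped_sin a b j t
         + b * damped_cos a b j t) by ring.
      apply is_derive_damped_sin.
    + unfold damped_sin. rewrite !Rmult_0_r, sin_0. ring.
    + apply is_lim_pow_exp; auto. intros; apply Rabs_sin_le_1.
Qed.

(** Integration by parts gives two linear equations for the cosine and sine integrals, with
    determinant a^2 + b^2; solving them is division by a + ib. *)
Lemma damped_recover (a b : R) (j : nat) (lc ls : R) : 0 < a ->
  primitive_0_inf (fun t => INR j * damped_cos a b (pred j) t) lc ->
  primitive_0_inf (fun t => INR j * damped_sin a b (pred j) t) ls ->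
  primitive_0_inf (damped_cos a b j) ((a * (lc + 0 ^ j) - b * ls) / (a ^ 2 + b ^ 2)) /\
  primitive_0_inf (damped_sin a b j) ((b * (lc + 0 ^ j) + a * ls) / (a ^ 2 + b ^ 2)).
Proof.
  intros Ha Hc Hs. assert (HD : a ^ 2 + b ^ 2 <> 0) by nra.
  assert (X := primitive_0_inf_plus _ _ _ _ Hc
    (primitive_0_inf_scal (-1) _ _ (primitive_derive_damped_cos a b j Ha))).
  assert (Y := primitive_0_inf_plus _ _ _ _ Hs
    (primitive_0_inf_scal (-1) _ _ (primitive_derive_damped_sin a b j Ha))).
  split.
  - replace (_ / _) with (a / (a ^ 2 + b ^ 2) * (lc + -1 * - 0 ^ j)
      + (- b / (a ^ 2 + b ^ 2)) * (ls + -1 * 0)) by (field; auto).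
    refine (primitive_0_inf_ext _ _ _ _ (primitive_0_inf_plus _ _ _ _
      (primitive_0_inf_scal (a / (a ^ 2 + b ^ 2)) _ _ X)
      (primitive_0_inf_scal (- b / (a ^ 2 + b ^ 2)) _ _ Y))).
    intros t; cbv beta. field; auto.
  - replace ((b * (lc + 0 ^ j) + a * ls) / (a ^ 2 + b ^ 2)) with (b / (a ^ 2 + b ^ 2) * (lc + -1 * - 0 ^ j)
      + (a / (a ^ 2 + b ^ 2)) * (ls + -1 * 0)) by (field; auto).
    refine (primitive_0_inf_ext _ _ _ _ (primitive_0_inf_plus _ _ _ _
      (primitive_0_inf_scal (b / (a ^ 2 + b ^ 2)) _ _ X)
      (primitive_0_inf_scal (a / (a ^ 2 + b ^ 2)) _ _ Y))).
    intros t; cbv beta. field; auto.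
Qed.

(* [int_0^oo t^j e^{-zt} dt = j! / z^(j+1)] for [z = a + ib], in real and imaginary parts. *)
Lemma primitive_damped (a b : R) (j : nat) : 0 < a ->
  primitive_0_inf (damped_cos a b j) (INR (fact j) * Re (/ (a, b) ^ S j)) /\
  primitive_0_inf (damped_sin a b j) (- (INR (fact j) * Im (/ (a, b) ^ S j))).
Proof.
  intros Ha. assert (HD : a ^ 2 + b ^ 2 <> 0) by nra.
  assert (Hz : ((a, b) : C) <> 0) by (intros H; apply (f_equal fst) in H; simpl in H; lra).
  induction j as [|j [IHc IHs]].
  (* For j = 0 the lower integrals carry the factor [INR 0], so [damped_recover] supplies the base
     case too. *)
  - assert (Z : forall f : R -> R, primitive_0_inf (fun t => INR 0 * f t) 0).
    { intros f. apply primitive_0_inf_ext with (2 := primitive_0_inf_0).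
      intros; simpl; ring. }
    destruct (damped_recover a b 0 0 0 Ha (Z _) (Z _)) as [P Q].
    rewrite Cpow_1_r. split.
    + replace (INR (fact 0) * _) with ((a * (0 + 0 ^ 0) - b * 0) / (a ^ 2 + b ^ 2));
        [exact P|]. unfold Re; simpl; field; nra.
    + replace (- (INR (fact 0) * _)) with ((b * (0 + 0 ^ 0) + a * 0) / (a ^ 2 + b ^ 2));
        [exact Q|]. unfold Im; simpl; field; nra.
  - destruct (damped_recover a b (S j) _ _ Ha (primitive_0_inf_scal (INR (S j)) _ _ IHc)
      (primitive_0_inf_scal (INR (S j)) _ _ IHs)) as [P Q].
    assert (E : (/ (a, b) ^ S (S j) = / (a, b) * / (a, b) ^ S j)%C).
    { rewrite (Cpow_S (a, b) (S j)). field. split; auto. apply Cpow_nz; auto. }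
    rewrite E. change (fact (S j)) with (S j * fact j)%nat. rewrite mult_INR.
    rewrite pow_ne_zero in P, Q by lia. set (w := (/ (a, b) ^ S j)%C) in *. split.
    + replace (INR (S j) * _ * _) with
        ((a * (INR (S j) * (INR (fact j) * Re w) + 0)
          - b * (INR (S j) * - (INR (fact j) * Im w))) / (a ^ 2 + b ^ 2)); [exact P|].
      unfold Cmult, Cinv, Re, Im. cbn [fst snd]. field; auto.
    + replace (- (INR (S j) * _ * _)) with
        ((b * (INR (S j) * (INR (fact j) * Re w) + 0)
          + a * (INR (S j) * - (INR (fact j) * Im w))) / (a ^ 2 + b ^ 2)); [exact Q|].
      unfold Cmult, Cinv, Re, Im. cbn [fst snd]. field; auto.
Qed.

(** This replaces dominated convergence: the integral of f is given, those of g and h are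
    differences of primitives, and all three are compared on one interval [a, b]. *)
Lemma improper_int_compare (f g h : R -> R) (I lg lh : R) :
  improper_int_0_inf f I -> primitive_0_inf g lg -> primitive_0_inf h lh ->
  (forall t, 0 < t -> Rabs (f t - g t) <= h t) -> Rabs (I - lg) <= lh.
Proof.
  intros HI [gc [G [HG [G0 GL]]]] [hc [H [HH [H0 HL]]]] B.
  apply le_epsilon. intros e He.
  (* The five errors are the truncation of f and, for both G and H, the values near 0 and near
     infinity. *)
  set (e' := e / 5). assert (He' : 0 < e') by (unfold e'; lra).
  destruct (HI e' He') as [d [M [Hd [HM K]]]].
  assert (NG : forall F : R -> R, is_lim F p_infty 0 -> exists M', forall b, M' < b -> Rabs (F b) < e').
  { intros F HF. apply is_lim_spec in HF. destruct (HF (mkposreal e' He')) as [M' HM'].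
    exists M'. intros b Hb. specialize (HM' b Hb). simpl in HM'. rewrite Rminus_0_r in HM'. auto. }
  assert (N0 : forall F f' : R -> R, (forall t, is_derive F t (f' t)) ->
     exists d', 0 < d' /\ forall a, 0 < a < d' -> Rabs (F a - F 0) < e').
  { intros F f' HF. assert (CF : continuous F 0) by (apply (ex_derive_continuous F 0); eexists; apply HF).
    destruct (proj1 (filterlim_locally F (F 0)) CF (mkposreal e' He')) as [d' Hd'].
    exists d'. split; [apply cond_pos|]. intros a Ha. apply Hd'.
    unfold ball; simpl; unfold AbsRing_ball, abs, minus, plus, opp; simpl.
    rewrite Rabs_pos_eq; lra. }
  destruct (NG G GL) as [M1 HM1]. destruct (NG H HL) as [M2 HM2].
  destruct (N0 G g HG) as [d1 [Hd1 Kd1]]. destruct (N0 H h HH) as [d2 [Hd2 Kd2]].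
  set (a := Rmin d (Rmin d1 d2) / 2).
  (* Including d ensures a < d < b. *)
  set (b := Rmax (Rmax M d) (Rmax M1 M2) + 1).
  assert (Ha : 0 < a /\ a < d /\ a < d1 /\ a < d2).
  { assert (0 < Rmin d (Rmin d1 d2)) by (repeat apply Rmin_glb_lt; auto).
    assert (Rmin d (Rmin d1 d2) <= d) by apply Rmin_l.
    assert (Rmin d (Rmin d1 d2) <= Rmin d1 d2) by apply Rmin_r.
    assert (Rmin d1 d2 <= d1) by apply Rmin_l. assert (Rmin d1 d2 <= d2) by apply Rmin_r.
    unfold a; lra. }
  assert (Hb : M < b /\ d < b /\ M1 < b /\ M2 < b).
  { assert (T1 := Rmax_l (Rmax M d) (Rmax M1 M2)). assert (T2 := Rmax_r (Rmax M d) (Rmax M1 M2)).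
    assert (T3 := Rmax_l M d). assert (T4 := Rmax_r M d).
    assert (T5 := Rmax_l M1 M2). assert (T6 := Rmax_r M1 M2). unfold b; lra. }
  destruct (K a b) as [pr Hpr]; [lra|lra|].
  assert (If := ex_RInt_Reals_aux_1 f a b pr).
  assert (Ig : is_RInt g a b (G b - G a)) by (apply (is_RInt_derive G g); auto).
  assert (Ih : is_RInt h a b (H b - H a)) by (apply (is_RInt_derive H h); auto).
  assert (Q : Rabs (RiemannInt pr - (G b - G a)) <= H b - H a).
  { apply (norm_RInt_le (fun t => minus (f t) (g t)) h a b
      (minus (RiemannInt pr) (G b - G a)) (H b - H a)); auto; [lra| |].
    - intros t Ht. apply B. lra.
    - apply (is_RInt_minus f g a b); auto. }
  specialize (HM1 b ltac:(lra)). specialize (HM2 b ltac:(lra)).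
  specialize (Kd1 a ltac:(lra)). specialize (Kd2 a ltac:(lra)).
  rewrite G0 in Kd1. rewrite H0 in Kd2.
  apply Rabs_def2 in HM1, HM2, Kd1, Kd2, Hpr. apply Rabs_le_between in Q.
  apply Rabs_le. unfold e' in *. lra.
Qed.

(** * Expansion of the integrand *)

Definition side_cos (A : nat) (t : R) : R :=
  rsum (fun c => cos ((INR c - INR A) * t)) (2 * A).

Lemma side_cos_S (A : nat) (t : R) :
  side_cos (S A) t = side_cos A t + cos (INR A * t) + cos (INR (S A) * t).
Proof.
  unfold side_cos. replace (2 * S A)%nat with (S (S (2 * A))) by lia.
  rewrite rsum_first.
  change (rsum (fun k => cos ((INR (S k) - INR (S A)) * t)) (S (2 * A))) with
   (rsum (fun k => cos ((INR (S k) - INR (S A)) * t)) (2 * A)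
    + cos ((INR (S (2 * A)) - INR (S A)) * t)).
  rewrite (rsum_ext (fun k => cos ((INR (S k) - INR (S A)) * t))
            (fun c => cos ((INR c - INR A) * t))).
  2:{ intros k _. rewrite !S_INR. f_equal; ring. }
  replace ((INR 0 - INR (S A)) * t) with (- (INR (S A) * t)) by (change (INR 0) with 0; ring).
  rewrite cos_neg. rewrite !S_INR, mult_INR. simpl (INR 2).
  replace ((1 + 1) * INR A + 1 - (INR A + 1)) with (INR A) by ring. ring.
Qed.

(* [side_cos A t = sin(At) cot(t/2)], multiplied out so that it also holds where [sin(t/2) = 0]. *)
Lemma side_cos_closed (A : nat) (t : R) :
  (1 - cos t) * side_cos A t = sin (INR A * t) * sin t.
Proof.
  induction A as [|A IH].
  - unfold side_cos; simpl. rewrite Rmult_0_l, sin_0. ring.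
  - rewrite side_cos_S. rewrite !Rmult_plus_distr_l, IH.
    rewrite S_INR, Rmult_plus_distr_r, Rmult_1_l, cos_plus, sin_plus.
    assert (E := sin2_cos2 t). unfold Rsqr in E.
    set (s := sin t) in *. set (c := cos t) in *.
    set (sa := sin (INR A * t)). set (ca := cos (INR A * t)).
    replace (sa * s + (1 - c) * ca + (1 - c) * (ca * c - sa * s))
      with (sa * s * c + ca * (1 - c * c)) by ring.
    replace (1 - c * c) with (s * s) by lra. ring.
Qed.

(** This is the Chebyshev recurrence of sin(At). The second difference of [side_cos] is cos((A+2)t)
    - cos(At), which [side_cos_closed] turns into -2 (1 - cos t) [side_cos (S A) t] without dividing
    by 1 - cos t. *)
Lemma side_cos_rec (A : nat) (t : R) :
  side_cos (S (S A)) t = 2 * cos t * side_cos (S A) t - side_cos A t.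
Proof.
  rewrite (side_cos_S (S A)).
  assert (E := side_cos_closed (S A) t).
  assert (E2 := side_cos_S A t).
  assert (E3 : cos (INR (S (S A)) * t) - cos (INR A * t) = - 2 * (sin (INR (S A) * t) * sin t)).
  { replace (INR (S (S A)) * t) with (INR (S A) * t + t) by (rewrite (S_INR (S A)); ring).
    replace (INR A * t) with (INR (S A) * t - t) by (rewrite S_INR; ring).
    rewrite cos_plus, cos_minus. ring. }
  rewrite <- E in E3. lra.
Qed.

Lemma Rabs_side_cos_le (A : nat) (t : R) : Rabs (side_cos A t) <= 2 * INR A.
Proof.
  unfold side_cos. eapply Rle_trans; [apply (Rabs_rsum_le _ (fun _ => 1))|].
  - intros; apply Rabs_cos_le_1.
  - rewrite rsum_const, mult_INR. simpl (INR 2). lra.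
Qed.

(** The factor in front is the characteristic polynomial of [side_cos_rec], so the sum telescopes.
    At p = e^(-t) it is the denominator of [f1i], and 1 + cos t = 2 cos^2(t/2) matches the
    numerator. *)
Lemma side_cos_gen (N : nat) (p t : R) :
  (1 - 2 * p * cos t + p ^ 2) * rsum (fun A => p ^ A * side_cos A t) (S N)
  = p * (1 + cos t) - p ^ S N * side_cos (S N) t + p ^ S (S N) * side_cos N t.
Proof.
  induction N as [|N IH].
  - assert (E0 : side_cos 0 t = 0) by reflexivity.
    assert (E1 : side_cos 1 t = 1 + cos t).
    { rewrite side_cos_S, E0. change (INR 0) with 0. change (INR 1) with 1.
      rewrite Rmult_0_l, Rmult_1_l, cos_0. ring. }
    cbn [rsum]. rewrite E0, E1. ring.
  - change (rsum (fun A => p ^ A * side_cos A t) (S (S N))) with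
      (rsum (fun A => p ^ A * side_cos A t) (S N) + p ^ S N * side_cos (S N) t).
    rewrite Rmult_plus_distr_l, IH, side_cos_rec. simpl. ring.
Qed.

Lemma exp_INR_mult (A : nat) (t : R) : exp (- INR A * t) = exp (- t) ^ A.
Proof.
  induction A as [|A IH].
  - simpl. rewrite Ropp_0, Rmult_0_l. apply exp_0.
  - rewrite S_INR. change (exp (- t) ^ S A) with (exp (- t) * exp (- t) ^ A).
    rewrite <- IH, <- exp_plus. f_equal; ring.
Qed.

Lemma one_minus_exp_ge (t : R) : 0 <= t -> t * exp (- t) <= 1 - exp (- t).
Proof.
  intros Ht. assert (E := exp_ineq1_le t). assert (P := exp_pos (- t)).
  assert (Q : exp (- t) * exp t = 1) by (rewrite <- exp_plus, Rplus_opp_l; apply exp_0).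
  nra.
Qed.

(** With p = e^(-t), the denominator is at least (1-p)^2 >= t^2 p^2. The weight t^2 cancels its
    vanishing at 0, and the p^2 lowers the remainder p^(N+2) to p^N. *)
Lemma f1i_expand (N : nat) (t : R) : 0 < t ->
  Rabs (exp (- t) * f1i t - / 2 * rsum (fun A => exp (- INR A * t) * side_cos A t) (S (S N)))
  * t ^ 2 <= 2 * (INR N + 2) * exp (- INR N * t).
Proof.
  intros Ht. unfold f1i.
  set (p := exp (- t)). assert (Hp : 0 < p) by apply exp_pos.
  assert (Hp1 : t * p <= 1 - p) by (apply one_minus_exp_ge; lra).
  rewrite (rsum_ext _ (fun A => p ^ A * side_cos A t)).
  2:{ intros A _. rewrite exp_INR_mult. reflexivity. }
  rewrite exp_INR_mult. fold p.
  replace (exp (- 2 * t)) with (p ^ 2).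
  2:{ unfold p. rewrite <- exp_INR_mult. simpl INR. f_equal; ring. }
  set (den := 1 - 2 * p * cos t + p ^ 2).
  assert (C := COS_bound t).
  assert (Hden : t ^ 2 * p ^ 2 <= den).
  { apply Rle_trans with ((1 - p) ^ 2).
    - rewrite <- Rpow_mult_distr. apply pow_incr. nra.
    - unfold den. nra. }
  assert (Hd0 : 0 < den).
  { eapply Rlt_le_trans; [|exact Hden]. apply Rmult_lt_0_compat; apply pow_lt; lra. }
  assert (G := side_cos_gen (S N) p t). fold den in G.
  set (s := rsum _ (S (S N))) in *.
  assert (E : cos (t / 2) ^ 2 = (1 + cos t) / 2).
  { replace (cos t) with (cos (2 * (t / 2))) by (f_equal; field).
    rewrite cos_2a_cos. field. }
  rewrite E.
  set (d := p ^ S (S N) * side_cos (S (S N)) t - p ^ S (S (S N)) * side_cos (S N) t).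
  replace (p * ((1 + cos t) / 2 / den) - / 2 * s) with (/ 2 * (d / den)).
  2:{ replace (p * ((1 + cos t) / 2 / den)) with (p * (1 + cos t) / (2 * den)) by (field; lra).
      replace (p * (1 + cos t)) with (den * s + d) by (unfold d; lra). field; lra. }
  assert (Bd : Rabs d <= 4 * (INR N + 2) * p ^ S (S N)).
  { assert (Hpp : 0 < p ^ S (S N)) by (apply pow_lt; auto).
    assert (B1 := Rabs_side_cos_le (S (S N)) t). assert (B2 := Rabs_side_cos_le (S N) t).
    rewrite !S_INR in B1. rewrite S_INR in B2. assert (HN := pos_INR N).
    unfold d. change (p ^ S (S (S N))) with (p * p ^ S (S N)).
    eapply Rle_trans; [apply Rabs_triang|].
    rewrite Rabs_Ropp, !Rabs_mult, (Rabs_pos_eq p), (Rabs_pos_eq (p ^ S (S N))) by lra.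
    assert (B3 : p * (p ^ S (S N)) <= p ^ S (S N)) by nra.
    assert (B4 := Rabs_pos (side_cos (S N) t)).
    assert (p * p ^ S (S N) * Rabs (side_cos (S N) t) <= p ^ S (S N) * (2 * (INR N + 1))).
    { apply Rmult_le_compat; auto. apply Rmult_le_pos; lra. }
    assert (p ^ S (S N) * Rabs (side_cos (S (S N)) t) <= p ^ S (S N) * (2 * (INR N + 1 + 1))).
    { apply Rmult_le_compat_l; lra. }
    nra. }
  rewrite Rabs_mult, (Rabs_pos_eq (/ 2)) by lra.
  unfold Rdiv. rewrite Rabs_mult, (Rabs_pos_eq (/ den)) by (apply Rlt_le, Rinv_0_lt_compat; auto).
  apply Rmult_le_reg_r with den; auto.
  replace (/ 2 * (Rabs d * / den) * t ^ 2 * den) with (/ 2 * Rabs d * t ^ 2) by (field; lra).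
  assert (HN := pos_INR N).
  apply Rle_trans with (/ 2 * (4 * (INR N + 2) * p ^ S (S N)) * t ^ 2).
  - apply Rmult_le_compat_r; [apply pow_le; lra|]. lra.
  - replace (/ 2 * (4 * (INR N + 2) * p ^ S (S N)) * t ^ 2)
      with (2 * (INR N + 2) * p ^ N * (t ^ 2 * p ^ 2)) by (simpl; field).
    apply Rmult_le_compat_l; auto.
    apply Rmult_le_pos; [lra|]. apply pow_le; lra.
Qed.

(** The undamped case A = 0 has an empty side, so every exponential that occurs has a positive
    rate. *)
Lemma primitive_side_cos (m N : nat) :
  primitive_0_inf (fun t => t ^ m * rsum (fun A => exp (- INR A * t) * side_cos A t) N)
    (INR (fact m) * rsum (shell_sum (S m)) N).
Proof.
  rewrite <- rsum_scal.
  apply primitive_0_inf_ext with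
    (fun t => rsum (fun A => rsum (fun c => damped_cos (INR A) (INR c - INR A) m t) (2 * A)) N).
  { intros t. rewrite <- rsum_scal. apply rsum_ext; intros A _. unfold side_cos, damped_cos.
    rewrite <- !rsum_scal. reflexivity. }
  apply (primitive_0_inf_rsum
    (fun A t => rsum (fun c => damped_cos (INR A) (INR c - INR A) m t) (2 * A))). intros A _.
  unfold shell_sum. rewrite <- rsum_scal.
  apply (primitive_0_inf_rsum (fun c => damped_cos (INR A) (INR c - INR A) m)). intros c Hc.
  apply primitive_damped. apply lt_0_INR; lia.
Qed.

(** * The hypergeometric polynomial as a binomial sum *)

Lemma poch_pos (a : R) (k : nat) : 0 < a -> 0 < poch a k.
Proof.
  intros Ha. induction k as [|k IH]; simpl; [lra|].
  apply Rmult_lt_0_compat; auto. assert (H := pos_INR k). lra.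
Qed.

(** Both sides have the same ratio of consecutive terms: four Pochhammer factors above and four
    below are, up to 4^4, the four new factors in the falling factorial of 4n and in (4k+4)!. *)
Lemma F43_coef (n k : nat) : (k <= n)%nat ->
  poch (1/4 - INR n) k * poch (1/2 - INR n) k * poch (3/4 - INR n) k * poch (- INR n) k
    / (poch (1/4) k * poch (1/2) k * poch (3/4) k) / INR (fact k)
  = Binomial.C (4 * n) (4 * k).
Proof.
  assert (F : forall m, INR (fact m) <> 0) by apply INR_fact_neq_0.
  induction k as [|k IH]; intros Hk.
  - simpl poch. change (fact 0) with 1%nat. unfold Binomial.C.
    rewrite Nat.mul_0_r, Nat.sub_0_r. simpl (fact 0). simpl (INR 1). field. apply F.
  - specialize (IH ltac:(lia)).
    assert (P1 := poch_pos (1/4) k ltac:(lra)). assert (P2 := poch_pos (1/2) k ltac:(lra)).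
    assert (P3 := poch_pos (3/4) k ltac:(lra)).
    assert (HK := pos_INR k).
    transitivity (Binomial.C (4 * n) (4 * k) *
      ((1/4 - INR n + INR k) * (1/2 - INR n + INR k) * (3/4 - INR n + INR k) * (- INR n + INR k)
        / ((1/4 + INR k) * (1/2 + INR k) * (3/4 + INR k) * INR (S k)))).
    + rewrite <- IH. change (fact (S k)) with (S k * fact k)%nat. rewrite mult_INR.
      cbn [poch]. rewrite S_INR. field. repeat split; try lra; apply F.
    + unfold Binomial.C.
      (* Expressing n through q removes the truncated subtraction, and the factorials reduce to
         those of 4n, 4k and q. *)
      remember (4 * n - 4 * S k)%nat as q eqn:Eq.
      replace (4 * n - 4 * k)%nat with (S (S (S (S q)))) by lia.
      assert (EN : INR n = INR q / 4 + INR k + 1).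
      { assert (E : (4 * n = q + 4 * k + 4)%nat) by lia.
        apply (f_equal INR) in E. rewrite !plus_INR, !mult_INR in E.
        replace (INR 4) with 4 in E by (simpl; ring). lra. }
      replace (4 * S k)%nat with (S (S (S (S (4 * k))))) by lia.
      generalize (F (4 * n)%nat) (F (4 * k)%nat) (F q).
      rewrite !fact_simpl, !mult_INR, !S_INR, mult_INR, EN.
      replace (INR 4) with 4 by (simpl; ring).
      generalize (INR (fact (4 * n))) (INR (fact (4 * k))) (INR (fact q)).
      intros x y z Hx Hy Hz. assert (HQ := pos_INR q). field.
      repeat split; try lra; auto.
Qed.

(** The -1 cancels the constant term of the polynomial, and each remaining power of t absorbs the
    factor 1/t. *)
Lemma CH_integrand_expand (om : R) (n : nat) (t : R) : om <> 0 -> t <> 0 ->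
  CH_integrand om n t
  = rsum (fun j => Binomial.C (4 * n) (4 * S j) / om ^ (4 * S j) * t ^ (4 * j + 3)
                   * (exp (- t) * f1i t)) n.
Proof.
  intros Hom Ht. unfold CH_integrand, F43.
  rewrite (rsum_ext _ (fun k => Binomial.C (4 * n) (4 * k) * (t ^ 4 / om ^ 4) ^ k)).
  2:{ intros k Hk. rewrite <- F43_coef by lia. unfold Rdiv. ring. }
  rewrite rsum_first.
  replace (Binomial.C (4 * n) (4 * 0)) with 1.
  2:{ rewrite <- F43_coef by lia. simpl. field. }
  rewrite pow_O.
  replace (/ t * exp (- t) * f1i t * (-1 + (1 * 1 + _))) with
   (/ t * exp (- t) * f1i t
    * rsum (fun k => Binomial.C (4 * n) (4 * S k) * (t ^ 4 / om ^ 4) ^ S k) n) by ring.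
  rewrite <- rsum_scal. apply rsum_ext; intros k _.
  unfold Rdiv at 1. rewrite Rpow_mult_distr, pow_inv, <- !pow_mult.
  replace (t ^ (4 * S k)) with (t * t ^ (4 * k + 3)).
  2:{ replace (4 * S k)%nat with (S (4 * k + 3)) by lia. reflexivity. }
  field. split; auto. apply pow_nonzero; auto.
Qed.

(** * The period, the value of the integral and the recurrence *)

(** The integrand is at least 1, so integrating up to some c >= 1/2 gives at least 1/2; an error
    below 1/4 leaves om/2 > 1/4. *)
Lemma lemniscate_period_pos (om : R) :
  improper_int_right (fun x => / sqrt (1 - x ^ 4)) 0 1 (om / 2) -> 0 < om.
Proof.
  intros H. destruct (H (/ 4)) as [d [Hd K]]; [lra|].
  set (c := Rmax (1 / 2) (1 - d / 2)).
  assert (Hc : 1 / 2 <= c /\ 1 - d < c /\ c < 1).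
  { assert (T1 := Rmax_l (1 / 2) (1 - d / 2)). assert (T2 := Rmax_r (1 / 2) (1 - d / 2)).
    repeat split; unfold c; try lra. apply Rmax_lub_lt; lra. }
  destruct (K c) as [pr Hpr]; [lra|].
  assert (L : c <= RiemannInt pr).
  { apply (is_RInt_le (fun _ => 1) (fun x => / sqrt (1 - x ^ 4)) 0 c); [lra| | |].
    - assert (T := @is_RInt_const R_NormedModule 0 c 1).
      change (scal (c - 0) 1) with ((c - 0) * 1) in T.
      replace ((c - 0) * 1) with c in T by ring. exact T.
    - apply ex_RInt_Reals_aux_1.
    - intros x Hx. assert (Px : 0 < x ^ 4 < 1).
      { split; [apply pow_lt; lra|]. assert (x ^ 2 < 1) by nra. replace (x ^ 4) with (x ^ 2 * x ^ 2) by ring.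
        assert (0 <= x ^ 2) by apply pow2_ge_0. nra. }
      rewrite <- Rinv_1. apply Rinv_le_contravar.
      + apply sqrt_lt_R0; lra.
      + apply Rle_trans with (sqrt 1); [apply sqrt_le_1_alt; lra|rewrite sqrt_1; lra]. }
  apply Rabs_def2 in Hpr. lra.
Qed.

Lemma CH_integral_approx (om : R) (n N : nat) (I : R) : 0 < om ->
  improper_int_0_inf (CH_integrand om n) I ->
  Rabs (I - rsum (fun j => Binomial.C (4 * n) (4 * S j) / om ^ (4 * S j) *
                  (/ 2 * (INR (fact (4 * j + 3)) * rsum (shell_sum (4 * S j)) (S (S (S N)))))) n)
  <= rsum (fun j => Binomial.C (4 * n) (4 * S j) / om ^ (4 * S j) *
         (2 * INR (fact (4 * j + 1)) * ((INR N + 3) * / INR (S N) ^ (4 * j + 2)))) n.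
Proof.
  intros Hom HI.
  assert (Hq : forall j, (j < n)%nat -> 0 <= Binomial.C (4 * n) (4 * S j) / om ^ (4 * S j)).
  { intros j Hj. apply Rmult_le_pos.
    - unfold Binomial.C. apply Rmult_le_pos; [apply pos_INR|].
      apply Rlt_le, Rinv_0_lt_compat, Rmult_lt_0_compat; apply INR_fact_lt_0.
    - apply Rlt_le, Rinv_0_lt_compat, pow_lt; auto. }
  set (q := fun j => Binomial.C (4 * n) (4 * S j) / om ^ (4 * S j)) in *.
  set (s := fun t => rsum (fun A => exp (- INR A * t) * side_cos A t) (S (S (S N)))).
  (* [f1i_expand] is used at [S N] so that the majorant has a positive rate; taking b = 0 in
     [damped_cos] makes it a plain t^(4j+1) e^(-(N+1)t). *)
  apply (improper_int_compare (CH_integrand om n)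
    (fun t => rsum (fun j => q j * (/ 2 * (t ^ (4 * j + 3) * s t))) n)
    (fun t => rsum (fun j => q j * (2 * (INR (S N) + 2) * damped_cos (INR (S N)) 0 (4 * j + 1) t)) n)).
  - exact HI.
  - apply (primitive_0_inf_rsum (fun j t => q j * (/ 2 * (t ^ (4 * j + 3) * s t)))).
    intros j _. do 2 apply primitive_0_inf_scal. unfold s.
    replace (4 * S j)%nat with (S (4 * j + 3)) by lia.
    apply primitive_side_cos.
  - apply (primitive_0_inf_rsum
      (fun j t => q j * (2 * (INR (S N) + 2) * damped_cos (INR (S N)) 0 (4 * j + 1) t))).
    intros j _. apply primitive_0_inf_scal.
    replace (2 * INR (fact (4 * j + 1)) * ((INR N + 3) * / INR (S N) ^ (4 * j + 2)))
      with (2 * (INR (S N) + 2) * (INR (fact (4 * j + 1)) * Re (/ (INR (S N), 0) ^ S (4 * j + 1)))).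
    + apply primitive_0_inf_scal. apply primitive_damped, lt_0_INR; lia.
    + replace (S (4 * j + 1)) with (4 * j + 2)%nat by lia.
      assert (P : INR (S N) <> 0) by (apply not_0_INR; lia).
      change (INR (S N), 0) with (RtoC (INR (S N))).
      rewrite <- RtoC_pow, <- RtoC_inv by (apply pow_nonzero; auto).
      unfold Re; cbn [fst RtoC].
      generalize (/ INR (S N) ^ (4 * j + 2)). intros v. rewrite S_INR. ring.
  - intros t Ht. rewrite CH_integrand_expand by lra. fold q.
    rewrite <- rsum_minus. apply Rabs_rsum_le. intros j Hj. fold (q j).
    replace (q j * t ^ (4 * j + 3) * (exp (- t) * f1i t) - q j * (/ 2 * (t ^ (4 * j + 3) * s t)))
      with (q j * (t ^ (4 * j + 1) * ((exp (- t) * f1i t - / 2 * s t) * t ^ 2))).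
    2:{ replace (4 * j + 3)%nat with (4 * j + 1 + 2)%nat by lia. rewrite (pow_add t (4 * j + 1) 2); ring. }
    rewrite !Rabs_mult, (Rabs_pos_eq (q j)) by (apply Hq; auto).
    apply Rmult_le_compat_l; [apply Hq; auto|].
    rewrite (Rabs_pos_eq (t ^ (4 * j + 1))), (Rabs_pos_eq (t ^ 2)) by (apply pow_le; lra).
    unfold damped_cos. rewrite Rmult_0_l, cos_0, Rmult_1_r.
    replace (2 * (INR (S N) + 2) * (t ^ (4 * j + 1) * exp (- INR (S N) * t))) with
      (t ^ (4 * j + 1) * (2 * (INR (S N) + 2) * exp (- INR (S N) * t))) by ring.
    apply Rmult_le_compat_l; [apply pow_le; lra|].
    apply f1i_expand, Ht.
Qed.

Lemma CH_integral (om : R) (n : nat) (I : R) : 0 < om ->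
  improper_int_0_inf (CH_integrand om n) I ->
  I = rsum (fun j => Binomial.C (4 * n) (4 * S j) / om ^ (4 * S j) *
                  (/ 2 * (INR (fact (4 * j + 3)) * Series (shell_sum (4 * S j))))) n.
Proof.
  intros Hom HI.
  set (L := rsum _ n).
  set (u := fun N => rsum (fun j => Binomial.C (4 * n) (4 * S j) / om ^ (4 * S j) *
       (/ 2 * (INR (fact (4 * j + 3)) * rsum (shell_sum (4 * S j)) (S (S (S N)))))) n).
  assert (Lu : is_lim_seq u L).
  { apply (is_lim_seq_rsum (fun N j => Binomial.C (4 * n) (4 * S j) / om ^ (4 * S j) *
       (/ 2 * (INR (fact (4 * j + 3)) * rsum (shell_sum (4 * S j)) (S (S (S N))))))). intros j _.
    do 3 (apply is_lim_seq_mult'; [apply is_lim_seq_const|]).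
    assert (H := shell_sum_cvg (4 * S j) ltac:(lia)).
    apply (is_lim_seq_incr_n _ 2) in H.
    apply is_lim_seq_ext with (2 := H). intros N. f_equal. lia. }
  assert (Lu' : is_lim_seq u I).
  { replace (Finite I) with (Finite (I - 0)) by (f_equal; ring).
    apply is_lim_seq_ext with (fun N => I - (I - u N)); [intros; ring|].
    apply is_lim_seq_minus'; [apply is_lim_seq_const|].
    apply is_lim_seq_abs_0.
    apply is_lim_seq_le_le with (fun _ => 0)
     (fun N => rsum (fun j => Binomial.C (4 * n) (4 * S j) / om ^ (4 * S j) *
         (2 * INR (fact (4 * j + 1)) * ((INR N + 3) * / INR (S N) ^ (4 * j + 2)))) n).
    - intros N. split; [apply Rabs_pos|]. apply CH_integral_approx; auto.
    - apply is_lim_seq_const.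
    - replace (Finite 0) with (Finite (rsum (fun j => Binomial.C (4 * n) (4 * S j) / om ^ (4 * S j)
         * (2 * INR (fact (4 * j + 1)) * 0)) n)).
      2:{ f_equal. rewrite (rsum_ext _ (fun _ => 0)) by (intros; ring). rewrite rsum_const; ring. }
      apply (is_lim_seq_rsum (fun N j => Binomial.C (4 * n) (4 * S j) / om ^ (4 * S j) *
         (2 * INR (fact (4 * j + 1)) * ((INR N + 3) * / INR (S N) ^ (4 * j + 2))))). intros j _.
      do 2 (apply is_lim_seq_mult'; [apply is_lim_seq_const|]).
      (* The exponent is at least 2 and N + 3 <= 3 (N + 1). *)
      apply is_lim_seq_le_le with (fun _ => 0) (fun N => 3 * / INR (N + 1)).
      + intros N. rewrite Nat.add_1_r.
        assert (H1 : 1 <= INR (S N)) by (change 1 with (INR 1); apply le_INR; lia).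
        assert (HN := pos_INR N).
        assert (H2 := Rinv_pow_antitone (INR (S N)) 2 (4 * j + 2) H1 ltac:(lia)).
        assert (H3 : 0 < / INR (S N) ^ (4 * j + 2)) by (apply Rinv_0_lt_compat, pow_lt; lra).
        split; [nra|].
        apply Rle_trans with ((3 * INR (S N)) * / INR (S N) ^ 2).
        * apply Rmult_le_compat; try lra. rewrite S_INR; lra.
        * right; field; lra.
      + apply is_lim_seq_const.
      + replace (Finite 0) with (Finite (3 * 0)) by (f_equal; ring).
        apply is_lim_seq_mult'; [apply is_lim_seq_const|apply is_lim_seq_inv_INR_add]. }
  apply is_lim_seq_unique in Lu. apply is_lim_seq_unique in Lu'.
  rewrite Lu in Lu'. now injection Lu'.
Qed.

Lemma hurwitz_shell (om : R) (a : nat -> R) (k : nat) : 0 < om ->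
  a (4 * k + 2)%nat = 4 * (4 * INR k + 3) / om ^ (4 * S k) * Series (shell_sum (4 * S k)) ->
  4 ^ (2 * S k - 1) / (8 * INR (S k)) * hurwitz a (4 * S k)
  = / om ^ (4 * S k) * (/ 2 * (INR (fact (4 * k + 3)) * Series (shell_sum (4 * S k)))).
Proof.
  intros Hom E. unfold hurwitz.
  replace (4 * S k - 2)%nat with (4 * k + 2)%nat by lia. rewrite E.
  replace (fact (4 * k + 3)) with ((4 * k + 3) * fact (4 * k + 2))%nat.
  2:{ replace (4 * k + 3)%nat with (S (4 * k + 2)) by lia. reflexivity. }
  (* The power of 2 in the Hurwitz number cancels the power of 4 in the recurrence up to a factor
     4. *)
  replace (2 ^ (4 * S k)) with (4 * 4 ^ (2 * S k - 1)).
  2:{ replace (4 * S k)%nat with (2 * S (2 * S k - 1))%nat by lia.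
      rewrite pow_mult. replace (2 ^ 2) with 4 by ring. reflexivity. }
  assert (HK := pos_INR k).
  assert (0 < 4 ^ (2 * S k - 1)) by (apply pow_lt; lra).
  assert (0 < om ^ (4 * S k)) by (apply pow_lt; auto).
  rewrite !mult_INR, plus_INR, mult_INR, S_INR.
  replace (INR 4) with 4 by (simpl; ring). replace (INR 3) with 3 by (simpl; ring).
  field. lra.
Qed.

Theorem theorem15
  (om : R)
  (Hom : improper_int_right (fun x => / sqrt (1 - x ^ 4)) 0 1 (om / 2))
  (a : nat -> R) (r : R) (Hr : 0 < r)
  (Hlaurent : forall x, 0 < Rabs x < r ->
     exists s, Pser a x s /\ is_wp om (x, 0) (/ x ^ 2 + s, 0))
  (n : nat) (Hn : (1 <= n)%nat)
  (CnH : R) (HC : improper_int_0_inf (CH_integrand om n) CnH) :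
  4 ^ (2 * n - 1) / (8 * INR n) * hurwitz a (4 * n)
  = CnH - rsum (fun j =>
            let k := S j in
            Binomial.C (4 * n) (4 * k) * (4 ^ (2 * k - 1) / (8 * INR k))
              * hurwitz a (4 * k)) (n - 1).
Proof.
  apply lemniscate_period_pos in Hom.
  assert (E := laurent_coef om a r Hom Hr Hlaurent).
  rewrite (CH_integral om n CnH Hom HC).
  destruct n as [|n]; [lia|]. replace (S n - 1)%nat with n by lia.
  rewrite (rsum_ext _ (fun j => Binomial.C (4 * S n) (4 * S j)
    * (4 ^ (2 * S j - 1) / (8 * INR (S j)) * hurwitz a (4 * S j)))).
  2:{ intros j _. rewrite (hurwitz_shell om a j Hom (E j)). unfold Rdiv. ring. }
  (* The last summand has binomial coefficient 1 and is the left-hand side; the others are exactly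
     those subtracted. *)
  cbn [rsum]. cbv zeta.
  rewrite <- (rsum_ext (fun j => Binomial.C (4 * S n) (4 * S j)
    * (4 ^ (2 * S j - 1) / (8 * INR (S j))) * hurwitz a (4 * S j))) by (intros; ring).
  replace (Binomial.C (4 * S n) (4 * S n)) with 1.
  2:{ unfold Binomial.C. rewrite Nat.sub_diag. simpl (fact 0). simpl (INR 1).
      field. apply INR_fact_neq_0. }
  ring.
Qed.
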